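(* With $(X(t))$ stationary with distribution $\nu$, as $\varepsilon\to 0$, $$\mathbb{E}\big(\widetilde{B}^{\varepsilon}\big)=\frac{1}{\mu-\lambda}-\varepsilon\,\frac{\mathbb{E}_\nu[p(X(0))]}{(\mu-\lambda)^2}+o(\varepsilon).$$
   Context: Setting: $0<\lambda<\mu$. $(X(t))_{t\ge 0}$ is an ergodic Markov process on a state space $\mathcal{S}$ with invariant distribution $\nu$; it is taken stationary ($X(0)\sim\nu$), and $\mathbb{E}_\nu$ denotes expectation when $(X(t))$ is at equilibrium. $p:\mathcal{S}\to\mathbb{R}$ is a measurable function with $|p|$ bounded by a constant $M>0$, and $\varepsilon\ge 0$ satisfies $\varepsilon\sup_{x}|p(x)|<\mu$. Perturbed queue (P-Queue): $\widetilde{L}^{\varepsilon}(t)$ is the number of customers in an $M/M/1$ queue with time-varying service rate: $(\widetilde{L}^{\varepsilon}(t),X(t))$ is a Markov process in which $X$ evolves autonomously and, when $\widetilde{L}^{\varepsilon}(t)=l$ and $X(t)=x$, the queue jumps $l\to l+1$ at rate $\lambda$ and $l\to l-1$ at rate $(\mu+\varepsilon p(x))\mathbf{1}_{\{l>0\}}$. The busy period is $\widetilde{B}^{\varepsilon}=\inf\{s\ge 0:\widetilde{L}^{\varepsilon}(s)=0\}$ given $\widetilde{L}^{\varepsilon}(0)=1$. *)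

(* Defs.v *)
From HB Require Import structures.
From mathcomp Require Import all_boot all_order all_algebra.
From mathcomp Require Import all_classical all_reals all_analysis.
Set Implicit Arguments. Unset Strict Implicit. Unset Printing Implicit Defensive.
Import Order.TTheory GRing.Theory Num.Theory numFieldNormedType.Exports.
Local Open Scope classical_set_scope.
Local Open Scope ring_scope.

(* Time is indexed by R, and only times t >= 0 are ever constrained.
   A family of transition probabilities x |-> K_t(x, .) is encoded as a single
   kernel from R * E, so that K_t(x, A) is jointly measurable in (t, x). *)

Definition transition_function {d} {E : measurableType d} {R : realType}
    (K : R.-pker (R * E) ~> E) : Prop :=
  (forall x A, measurable A -> K (0, x) A = \d_x A) /\
  (forall s t x A, 0 <= s -> 0 <= t -> measurable A ->
     K (s + t, x) A = (\int[K (s, x)]_y K (t, y) A)%E).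

Definition invariant_distribution {d} {E : measurableType d} {R : realType}
    (K : R.-pker (R * E) ~> E) (nu : probability E R) : Prop :=
  forall t A, 0 <= t -> measurable A -> (\int[nu]_x K (t, x) A)%E = nu A.

(* The invariant sets of the semigroup are nu-trivial. *)
Definition ergodic {d} {E : measurableType d} {R : realType}
    (K : R.-pker (R * E) ~> E) (nu : probability E R) : Prop :=
  forall A, measurable A ->
    (forall t, 0 <= t -> {ae nu, forall x, K (t, x) A = (\1_A x)%:E}) ->
    nu A = 0%E \/ nu A = 1%E.

(* sigma(Z_s, 0 <= s <= t) *)
Definition history {d d'} {W : measurableType d} {E : measurableType d'}
    {R : realType} (Z : R -> W -> E) (t : R) : set (set W) :=
  <<s \bigcup_(s in [set s | 0 <= s <= t])
        preimage_set_system setT (Z s) measurable >>.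

(* P(Z_{s+t} \in A | Z_u, u <= s) = K_t(Z_s, A) *)
Definition markov_process {d d'} {W : measurableType d} {E : measurableType d'}
    {R : realType} (P : probability W R) (Z : R -> W -> E)
    (K : R.-pker (R * E) ~> E) : Prop :=
  (forall t, 0 <= t -> measurable_fun setT (Z t)) /\
  (forall s t F A, 0 <= s -> 0 <= t -> history Z s F -> measurable A ->
     P (F `&` Z (s + t) @^-1` A) = (\int[P]_(w in F) K (t, Z s w) A)%E).

Section PQueue.
Context {d} {S : measurableType d} {R : realType}.
Variables (K : R.-pker (R * S) ~> S) (lambda mu : R) (p : S -> R) (e : R).

Definition queue_generator (f : nat * S -> R) (z : nat * S) : R :=
  let: (l, x) := z in
  lambda * (f (l.+1, x) - f (l, x)) +
  (if (0 < l)%N then (mu + e * p x) * (f (l.-1, x) - f (l, x)) else 0).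

(* Motion without jumps of the queue: l is frozen, x moves according to K. *)
Definition frozen_queue (t : R) (f : nat * S -> R) (z : nat * S) : R :=
  \int[K (t, z.2)]_y f (z.1, y).

(* Q is the transition function with generator "generator of X, acting on x"
   + queue_generator.  As queue_generator is a bounded operator, this is the
   variation of constants formula
     Q_t f = K_t f + \int_0^t Q_s (queue_generator (K_{t-s} f)) ds
   for all bounded measurable f; it determines Q and, unlike an identity between
   generators, requires no description of the domain of the generator of X.
   For f depending on x only it gives Q_t f = K_t f (X is autonomous); for f
   depending on l only it is the forward equation
     Q_t f = f + \int_0^t Q_s (queue_generator f) ds. *)
Definition p_queue_transition
    (Q : R.-pker (R * (nat * S)) ~> (nat * S)%type) : Prop :=
  forall (f : nat * S -> R) (t : R) (z : nat * S),
    measurable_fun setT f -> (exists C, forall y, `|f y| <= C) -> 0 <= t ->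
    \int[Q (t, z)]_y f y =
    frozen_queue t f z +
    \int[lebesgue_measure]_(s in `[0, t])
      \int[Q (s, z)]_y queue_generator (frozen_queue (t - s) f) y.

(* (L, X) is the P-Queue with parameter e, started from L(0) = 1 and
   X(0) distributed as nu. *)
Definition p_queue (nu : probability S R) {d'} {W : measurableType d'}
    (P : probability W R) (L : R -> W -> nat) (X : R -> W -> S) : Prop :=
  [/\ exists Q : R.-pker (R * (nat * S)) ~> (nat * S)%type,
        [/\ transition_function Q, p_queue_transition Q &
            markov_process P (fun t w => (L t w, X t w)) Q],
      (forall w t, 0 <= t -> \forall s \near t^'+, L s w = L t w),
      {ae P, forall w, L 0 w = 1%N} &
      (forall A, measurable A -> P (X 0 @^-1` A) = nu A)].

End PQueue.

(* inf {s >= 0 : L(s) = 0}, equal to +oo if the queue never empties. *)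
Definition busy_period {R : realType} {W : Type} (L : R -> W -> nat) (w : W) :
    \bar R :=
  ereal_inf [set s%:E | s in [set s | 0 <= s /\ L s w = 0%N]].

(* The filter "epsilon -> 0, epsilon >= 0". *)
Definition nonneg_nbhs0 {R : realType} : set_system R :=
  within [set e : R | 0 <= e] (nbhs (0 : R)).

#[global] Instance nonneg_nbhs0_filter (R : realType) : Filter (@nonneg_nbhs0 R).
Proof. exact: within_filter. Qed.

(* Main.v *)
(* Only the values of L at the times of a grid of mesh t are observed, so that
   the Markov property at fixed times replaces the strong Markov property; the
   busy period is the limit, as the grid is refined, of the first grid time at
   which L vanishes.

   The death rate r(x) = mu + e p(x) lies in [mu - e M, mu + e M]. Let b be one
   of the two ends of this interval. For the M/M/1 queue with constant death
   rate b, independent of X, the mean time to empty and its increments in l are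
   explicit (1 / (b - lambda) per customer), and so is, by independence and
   stationarity, the mean of the integral of psi(X) over the busy period. These
   functionals, truncated at m grid steps, are used as test functions for the
   P-Queue. As r - b has a constant sign, replacing r by b costs a one-sided
   error, which a first order correction in psi compensates: b = mu - e M gives a
   lower bound for the mean busy period, b = mu + e M an upper bound, and both
   agree with the announced expansion up to O(e^2). *)
Require Import Defs.
From HB Require Import structures.
From mathcomp Require Import all_boot all_order all_algebra.
From mathcomp Require Import all_classical all_reals all_analysis.
From mathcomp Require Import measurable_realfun ring lra.
Set Implicit Arguments. Unset Strict Implicit. Unset Printing Implicit Defensive.
Import Order.TTheory GRing.Theory Num.Theory numFieldNormedType.Exports.
Local Open Scope classical_set_scope.
Local Open Scope ring_scope.

(** * Integrals of bounded measurable functions *)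

(** Write [g] for [b - lambda] and [r] for the death rate. The two ends agree to first order for the
    following reason: moving [b] away from [mu] by [e M] changes the M/M/1 mean [1 / g] at order
    [e], but the correction is the stationary mean of [b - r] divided by [g ^ 2], and its part
    [b - mu] undoes this change at that order. Only the mean of [e p] survives. The grid costs
    nothing in the limit: beyond the compensated error, each step of length [t] contributes O(t^2),
    uniformly in the state and in the truncation, and the mean number of steps is of order [1 / t].
    Truncation makes the summation over steps finite. Elapsed and remaining steps have a constant
    sum, so the boundary term is zero and no integrability has to be known beforehand. The two
    bounds are not independent. The busy period lies below every grid exit, so the upper bound needs
    no convergence of random variables. It also shows that the mean exit time of some grid is
    finite, and that exit time dominates those of the refined grids in the limit behind the lower
    bound. *)

Definition bounded_measurable {d} {T : measurableType d} {R : realType} (f : T -> R) :=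
  measurable_fun setT f /\ exists C : R, forall x, `|f x| <= C.

Section bounded_integrals.
Context d (T : measurableType d) (R : realType).
Implicit Types (f g h : T -> R) (D : set T) (m : {measure set T -> \bar R}).

Lemma bounded_measurable_cst (c : R) : bounded_measurable (fun _ : T => c).
Proof. by split; [exact: measurable_cst|exists `|c|]. Qed.

Lemma bounded_measurableD f g : bounded_measurable f -> bounded_measurable g ->
  bounded_measurable (fun x => f x + g x).
Proof.
move=> [mf [A Af]] [mg [B Bg]]; split; first exact: measurable_funD.
by exists (A + B) => x; rewrite (le_trans (ler_normD _ _))// lerD.
Qed.

Lemma bounded_measurableM f g : bounded_measurable f -> bounded_measurable g ->
  bounded_measurable (fun x => f x * g x).
Proof.
move=> [mf [A Af]] [mg [B Bg]]; split; first exact: measurable_funM.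
by exists (A * B) => x; rewrite normrM ler_pM.
Qed.

Lemma bounded_measurableB f g : bounded_measurable f -> bounded_measurable g ->
  bounded_measurable (fun x => f x - g x).
Proof.
move=> [mf [A Af]] [mg [B Bg]]; split; first exact: measurable_funB.
by exists (A + B) => x; rewrite (le_trans (ler_normB _ _))// lerD.
Qed.

Lemma bounded_measurable_integrable m D f : measurable D -> (m D < +oo)%E ->
  bounded_measurable f -> m.-integrable D (EFin \o f).
Proof.
move=> mD Doo [mf [C fC]]; apply: measurable_bounded_integrable => //.
  exact: measurable_funTS.
exists `|C|; split; first exact: num_real.
move=> y Cy x _ /=; apply: (le_trans (fC x)).
by rewrite (le_trans (ler_norm C))// ltW.
Qed.

(* No measurability is assumed of the function to be bounded: in the variation of
   constants formula, s |-> \int Q_s (queue_generator (K_{t-s} f)) is only known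
   to be bounded. *)
Lemma le_integral_nonmeasurable m D (f g : T -> \bar R) :
  (forall x, D x -> f x <= g x)%E ->
  (\int[m]_(x in D) f x <= \int[m]_(x in D) g x)%E.
Proof.
move=> fg; rewrite /integral.
have fgD x : ((f \_ D) x <= (g \_ D) x)%E.
  by rewrite !patchE; case: ifPn => // /set_mem; exact: fg.
apply: leeD; last (rewrite leeN2).
- apply: ge_ereal_sup => _ [h /= hf <-]; apply: ereal_sup_ubound.
  exists h => //= x; apply: (le_trans (hf x)).
  by rewrite !funeposE ge_max !le_max fgD/= lexx orbT.
- apply: ge_ereal_sup => _ [h /= hf <-]; apply: ereal_sup_ubound.
  exists h => //= x; apply: (le_trans (hf x)).
  by rewrite !funenegE ge_max !le_max leeN2 fgD/= lexx orbT.
Qed.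

Lemma le_Rintegral_nonmeasurable m D f g h : measurable D ->
  m.-integrable D (EFin \o f) -> m.-integrable D (EFin \o h) ->
  (forall x, D x -> f x <= g x) -> (forall x, D x -> g x <= h x) ->
  \int[m]_(x in D) f x <= \int[m]_(x in D) g x <= \int[m]_(x in D) h x.
Proof.
move=> mD intf inth fg gh.
have If := integrable_fin_num mD intf.
have Ih := integrable_fin_num mD inth.
have le1 : (\int[m]_(x in D) (f x)%:E <= \int[m]_(x in D) (g x)%:E)%E.
  by apply: le_integral_nonmeasurable => x Dx; rewrite lee_fin fg.
have le2 : (\int[m]_(x in D) (g x)%:E <= \int[m]_(x in D) (h x)%:E)%E.
  by apply: le_integral_nonmeasurable => x Dx; rewrite lee_fin gh.
have Ig : (\int[m]_(x in D) (g x)%:E)%E \is a fin_num.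
  move: If Ih le1 le2; rewrite /comp/=.
  by case: (integral m D _) => [a| |]; case: (integral m D _) => [b| |];
    case: (integral m D _) => [c| |].
by rewrite /Rintegral !fine_le.
Qed.

End bounded_integrals.

Section kernel_integrals.
Context d d' (X : measurableType d) (Y : measurableType d') (R : realType).
Variable k : R.-pker X ~> Y.
Implicit Types f g : Y -> R.

Lemma kernel_lty x : (k x setT < +oo)%E.
Proof. by rewrite prob_kernel ltry. Qed.

Lemma kernel_integrable f x : bounded_measurable f ->
  (k x).-integrable setT (EFin \o f).
Proof. by move=> bf; apply: bounded_measurable_integrable => //; exact: kernel_lty. Qed.

Lemma kernel_Rintegral_cst x (c : R) : \int[k x]_y c = c.
Proof. by rewrite Rintegral_cst// prob_kernel mulr1. Qed.

Lemma kernel_RintegralD x f g : bounded_measurable f -> bounded_measurable g ->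
  \int[k x]_y (f y + g y) = \int[k x]_y f y + \int[k x]_y g y.
Proof. by move=> bf bg; apply: RintegralD => //; exact: kernel_integrable. Qed.

Lemma kernel_RintegralB x f g : bounded_measurable f -> bounded_measurable g ->
  \int[k x]_y (f y - g y) = \int[k x]_y f y - \int[k x]_y g y.
Proof. by move=> bf bg; apply: RintegralB => //; exact: kernel_integrable. Qed.

Lemma kernel_RintegralZ x c f : bounded_measurable f ->
  \int[k x]_y (c * f y) = c * \int[k x]_y f y.
Proof. by move=> bf; apply: RintegralZl => //; exact: kernel_integrable. Qed.

Lemma le_kernel_Rintegral x f g : bounded_measurable f -> bounded_measurable g ->
  (forall y, f y <= g y) -> \int[k x]_y f y <= \int[k x]_y g y.
Proof. by move=> bf bg fg; apply: le_Rintegral => //; exact: kernel_integrable. Qed.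

Lemma kernel_Rintegral_le x f c : bounded_measurable f ->
  (forall y, f y <= c) -> \int[k x]_y f y <= c.
Proof.
move=> bf fc; rewrite -[leRHS](kernel_Rintegral_cst x).
by apply: le_kernel_Rintegral => //; exact: bounded_measurable_cst.
Qed.

Lemma kernel_Rintegral_ge x f c : bounded_measurable f ->
  (forall y, c <= f y) -> c <= \int[k x]_y f y.
Proof.
move=> bf fc; rewrite -[leLHS](kernel_Rintegral_cst x).
by apply: le_kernel_Rintegral => //; exact: bounded_measurable_cst.
Qed.

Lemma measurable_kernel_Rintegral f : bounded_measurable f ->
  measurable_fun setT (fun x => \int[k x]_y f y).
Proof.
move=> [mf [C fC]].
have C0 : 0 <= C by apply: le_trans (fC point).
have bf : bounded_measurable f by split => //; exists C.
have -> : (fun x => \int[k x]_y f y) =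
    (fun x => fine (\int[k x]_y (f y + C)%:E)%E - C).
  apply/funext => x.
  rewrite -[X in _ = X - _]/(\int[k x]_y (f y + C)) kernel_RintegralD//.
    by rewrite kernel_Rintegral_cst addrK.
  exact: bounded_measurable_cst.
apply: measurable_funB => //; apply: measurableT_comp => //.
apply: measurable_fun_integral_kernel.
- by move=> U mU; exact: measurable_kernel.
- by move=> z; rewrite lee_fin -lerBlDr sub0r; have := fC z; rewrite ler_norml => /andP[].
- by apply/measurable_EFinP; apply: measurable_funD.
Qed.

Lemma bounded_measurable_kernel_Rintegral f : bounded_measurable f ->
  bounded_measurable (fun x => \int[k x]_y f y).
Proof.
move=> bf; split; first exact: measurable_kernel_Rintegral.
have [mf [C fC]] := bf; exists C => x; rewrite ler_norml.
rewrite kernel_Rintegral_ge ?kernel_Rintegral_le// => y;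
by have := fC y; rewrite ler_norml => /andP[].
Qed.

End kernel_integrals.

(** * Integration against a mixture of probability kernels *)

Section mixture.
Context d d' (X : measurableType d) (Y : measurableType d') (R : realType).
Variables (m : {measure set X -> \bar R}) (k : R.-pker X ~> Y).
Hypothesis m_lty : (m setT < +oo)%E.

(** [m] and [k] are presented as two composable kernels issued from [unit]: the mixture is then
    their composition, and [integral_kcomp] applies. *)
Let kcst (u : unit) : {measure set X -> \bar R} := m.
Let ksnd (z : unit * X) : {measure set Y -> \bar R} := k z.2.

Let measurable_kcst U : measurable U -> measurable_fun setT (kcst ^~ U).
Proof. by move=> mU; exact: measurable_cst. Qed.

HB.instance Definition _ := isKernel.Build _ _ unit X R kcst measurable_kcst.

Let kcst_uub : measure_fam_uub kcst.
Proof.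
exists (fine (m setT) + 1) => x; rewrite /kcst EFinD fineK ?ge0_fin_numE//.
by rewrite lteDl ?ge0_fin_numE// lte01.
Qed.

HB.instance Definition _ := Kernel_isFinite.Build _ _ unit X R kcst kcst_uub.

Let measurable_ksnd U : measurable U -> measurable_fun setT (ksnd ^~ U).
Proof.
move=> mU; have := measurable_kernel k U mU => mk.
exact: (measurableT_comp mk).
Qed.

HB.instance Definition _ := isKernel.Build _ _ (unit * X)%type Y R ksnd measurable_ksnd.

Let ksnd_prob z : ksnd z setT = 1%E.
Proof. by rewrite /ksnd prob_kernel. Qed.

HB.instance Definition _ := Kernel_isProbability.Build _ _ (unit * X)%type Y R ksnd ksnd_prob.

Lemma ge0_integral_mixture (n : {measure set Y -> \bar R}) (f : Y -> \bar R) :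
  (forall A, measurable A -> n A = \int[m]_x k x A)%E ->
  (forall y, 0 <= f y)%E -> measurable_fun setT f ->
  (\int[n]_y f y = \int[m]_x \int[k x]_y f y)%E.
Proof.
move=> nE f0 mf.
rewrite -(@integral_kcomp _ _ _ _ _ _ _ kcst ksnd tt f f0 mf).
apply: eq_measure_integral => A mA _; exact: nE.
Qed.

Lemma Rintegral_mixture (n : {measure set Y -> \bar R}) (f : Y -> R) :
  (forall A, measurable A -> n A = \int[m]_x k x A)%E ->
  bounded_measurable f ->
  \int[n]_y f y = \int[m]_x \int[k x]_y f y.
Proof.
move=> nE bf; have [mf [C fC]] := bf.
have nT : n setT = m setT.
  rewrite nE//; under eq_integral do rewrite prob_kernel.
  by rewrite integral_cst// mul1e.
have nlty : (n setT < +oo)%E by rewrite nT.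
have bC : bounded_measurable (fun _ : Y => C) by exact: bounded_measurable_cst.
have bk := bounded_measurable_kernel_Rintegral k bf.
have kI : forall x, \int[k x]_y (f y + C) = \int[k x]_y f y + C.
  by move=> x; rewrite kernel_RintegralD// kernel_Rintegral_cst.
(* Adding the bound [C] makes the integrand nonnegative. The constant cancels afterwards because [n]
   and [m] have the same total mass. *)
have : \int[n]_y (f y + C) = \int[m]_x (\int[k x]_y f y + C).
  rewrite {1 2}/Rintegral (@ge0_integral_mixture n _ nE).
  - congr fine; apply: eq_integral => x _.
    rewrite -kI /Rintegral fineK//.
    apply: integrable_fin_num => //.
    by apply: kernel_integrable; exact: bounded_measurableD.
  - by move=> y; rewrite lee_fin -lerBlDr sub0r; have := fC y; rewrite ler_norml => /andP[].
  - by apply/measurable_EFinP; apply: measurable_funD.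
rewrite !RintegralD//; try exact: bounded_measurable_integrable.
  by rewrite !Rintegral_cst// nT => /addIr.
by apply: bounded_measurable_integrable => //; exact: bounded_measurable_cst.
Qed.

End mixture.

Section nat_product.
Context d (S : measurableType d) d' (Y : measurableType d') (R : realType).

Lemma measurable_fun_nat_product (f : nat * S -> Y) :
  (forall l, measurable_fun setT (fun x => f (l, x))) -> measurable_fun setT f.
Proof.
move=> mf; have -> : [set: nat * S] = \bigcup_l ([set l] `*` setT).
  by apply/seteqP; split => // -[l x] _; exists l.
apply/measurable_fun_bigcup => [l|l]; first exact: measurableX.
apply: (eq_measurable_fun (fun z => f (l, z.2))).
  by move=> [l' x] /[!inE] -[/= ->].
apply: measurable_funTS.
exact: (measurableT_comp (mf l)).
Qed.
End nat_product.

Section kernel_at.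
Context d (E : measurableType d) (R : realType) (K : R.-pker (R * E) ~> E) (t : R).

Definition kernel_at (x : E) : {measure set E -> \bar R} := K (t, x).

Let measurable_kernel_at U : measurable U -> measurable_fun setT (kernel_at ^~ U).
Proof.
move=> mU; apply: (measurableT_comp (measurable_kernel K U mU)).
exact: pair1_measurable.
Qed.

HB.instance Definition _ := isKernel.Build _ _ E E R kernel_at measurable_kernel_at.

Let kernel_at_prob x : kernel_at x setT = 1%E.
Proof. by rewrite /kernel_at prob_kernel. Qed.

HB.instance Definition _ := Kernel_isProbability.Build _ _ E E R kernel_at kernel_at_prob.

End kernel_at.

(** * The generator of the queue and the short-time behaviour of its transition function *)

Section queue.
Context d (S : measurableType d) (R : realType).
Variables (K : R.-pker (R * S) ~> S).
Variables (lambda mu e : R) (p : S -> R).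
Hypothesis bp : bounded_measurable p.
Local Notation A := (queue_generator lambda mu p e).
Implicit Types f g : nat * S -> R.

Lemma bounded_measurable_section f l : bounded_measurable f ->
  bounded_measurable (fun x => f (l, x)).
Proof.
move=> [mf [C fC]]; split; last by exists C.
by apply: (measurableT_comp mf); exact: pair1_measurable.
Qed.

Lemma frozen_queue_bound t f C z : bounded_measurable f ->
  (forall y, `|f y| <= C) -> `|frozen_queue K t f z| <= C.
Proof.
move=> bf fC; rewrite /frozen_queue ler_norml.
have bfl := bounded_measurable_section z.1 bf.
by rewrite kernel_Rintegral_ge ?kernel_Rintegral_le// => y;
  have := fC (z.1, y); rewrite ler_norml => /andP[].
Qed.

Lemma bounded_measurable_frozen t f : bounded_measurable f ->
  bounded_measurable (frozen_queue K t f).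
Proof.
move=> bf; have [mf [C fC]] := bf; split.
  apply: measurable_fun_nat_product => l; rewrite /frozen_queue/=.
  have bfl := bounded_measurable_section l bf.
  by apply: (measurableT_comp (measurable_kernel_Rintegral K bfl)); exact: pair1_measurable.
by exists C => z; exact: frozen_queue_bound.
Qed.

Lemma bounded_measurable_generator f : bounded_measurable f ->
  bounded_measurable (A f).
Proof.
move=> bf; have [mf [C fC]] := bf; have [mp [Cp pC]] := bp.
have bs l := bounded_measurable_section l bf.
have br : bounded_measurable (fun x => mu + e * p x).
  apply: bounded_measurableD; first exact: bounded_measurable_cst.
  by apply: bounded_measurableM => //; exact: bounded_measurable_cst.
split.
  apply: measurable_fun_nat_product => l; rewrite /queue_generator.
  have [] : bounded_measurable (fun x => lambda * (f (l.+1, x) - f (l, x)) +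
      (if (0 < l)%N then (mu + e * p x) * (f (l.-1, x) - f (l, x)) else 0)).
    apply: bounded_measurableD.
      apply: bounded_measurableM; first exact: bounded_measurable_cst.
      exact: bounded_measurableB.
    case: (0 < l)%N; last exact: bounded_measurable_cst.
    by apply: bounded_measurableM => //; exact: bounded_measurableB.
  by [].
have [_ [Cr rC]] := br.
have C0 : 0 <= C by apply: le_trans (fC point).
have Cr0 : 0 <= Cr by apply: le_trans (rC point).
exists (`|lambda| * (C + C) + Cr * (C + C)) => -[l x]; rewrite /queue_generator.
rewrite (le_trans (ler_normD _ _))// lerD//.
  rewrite normrM ler_wpM2l// (le_trans (ler_normB _ _))// lerD//.
case: ifP => _; last by rewrite normr0 mulr_ge0// addr_ge0.
rewrite normrM ler_pM// (le_trans (ler_normB _ _))// lerD//.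
Qed.

Lemma frozen_queueD s t f z : transition_function K -> bounded_measurable f ->
  0 <= s -> 0 <= t ->
  frozen_queue K s (frozen_queue K t f) z = frozen_queue K (s + t) f z.
Proof.
move=> [_ CK] bf s0 t0; rewrite /frozen_queue/=; symmetry.
apply: (@Rintegral_mixture _ _ _ _ _ (K (s, z.2)) (kernel_at K t)).
- exact: kernel_lty.
- by move=> A mA; exact: CK.
- exact: bounded_measurable_section.
Qed.

Variable Rb : R.
Hypothesis lambda0 : 0 <= lambda.
Hypothesis rate_bound : forall x, `|mu + e * p x| <= Rb.

(** The generator sees only increments in [l]. Test functions have increments bounded independently
    of the truncation, which need not hold for their sup norm, so the errors below are uniform in
    the truncation. *)
Lemma generator_bound f B z :
  (forall l x, `|f (l.+1, x) - f (l, x)| <= B) -> `|A f z| <= (lambda + Rb) * B.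
Proof.
move=> fB; case: z => l x; rewrite /queue_generator [leRHS]mulrDl.
have B0 : 0 <= B by apply: le_trans (fB 0%N point).
have Rb0 : 0 <= Rb by apply: le_trans (rate_bound point).
rewrite (le_trans (ler_normD _ _))// lerD//.
  by rewrite normrM ger0_norm// ler_wpM2l.
case: l => [|l] /=; first by rewrite normr0 mulr_ge0.
by rewrite normrM ler_pM// distrC.
Qed.

Section transition.
Variable Q : R.-pker (R * (nat * S)) ~> (nat * S)%type.
Hypothesis HQ : p_queue_transition K lambda mu p e Q.

Lemma lebesgue_measure_itv0 (t : R) : 0 <= t ->
  lebesgue_measure `[0, t]%classic = t%:E.
Proof.
move=> t0; rewrite lebesgue_measure_itv/= lte_fin sube0.
by case: ltgtP t0 => // <-.
Qed.

(** The two semigroups differ by the integral term of the variation of constants formula, whose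
    integrand lies between two constants given by [generator_bound], with increments at most
    [2 * C]. *)
Lemma transition_frozen_dist f C t z : bounded_measurable f ->
  (forall y, `|f y| <= C) -> 0 <= t ->
  `|\int[Q (t, z)]_y f y - frozen_queue K t f z| <= t * ((lambda + Rb) * (2 * C)).
Proof.
move=> bf fC t0; rewrite HQ//; [|by case: bf|by exists C].
rewrite addrAC subrr add0r.
set G := fun s => \int[Q (s, z)]_y A (frozen_queue K (t - s) f) y.
set B := (lambda + Rb) * (2 * C).
have GB s : `|G s| <= B.
  have bAf := bounded_measurable_generator (bounded_measurable_frozen (t - s) bf).
  have gb y : `|A (frozen_queue K (t - s) f) y| <= B.
    apply: generator_bound => l x; rewrite mulr_natl mulr2n.
    by rewrite (le_trans (ler_normB _ _))// lerD// frozen_queue_bound.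
  by rewrite ler_norml kernel_Rintegral_ge ?kernel_Rintegral_le// => y;
    have := gb y; rewrite ler_norml => /andP[].
have ic c : lebesgue_measure.-integrable `[0, t]%classic (EFin \o (fun _ : R => c)).
  apply: bounded_measurable_integrable => //; last exact: bounded_measurable_cst.
  by rewrite [X in (X < _)%E](lebesgue_measure_itv0 t0) ltry.
have := @le_Rintegral_nonmeasurable _ _ _ lebesgue_measure `[0, t]%classic
  (fun=> - B) G (fun=> B).
rewrite !Rintegral_cst// (_ : fine _ = t)/=; last first.
  by rewrite [X in fine X](lebesgue_measure_itv0 t0).
move=> H.
rewrite ler_norml mulrC -mulNr; apply: H => // s _;
  by have := GB s; rewrite ler_norml => /andP[].
Qed.

End transition.

End queue.

Lemma probability_lty d (T : measurableType d) (R : realType) (P : probability T R) :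
  (P setT < +oo)%E.
Proof. by rewrite probability_setT ltry. Qed.

(** * Additive functionals of X over one time step *)

Section time_integral.
Context d (S : measurableType d) (R : realType) (K : R.-pker (R * S) ~> S).

(** The mean, given X(0) = x, of the integral of u(X(s)) over [0, t]: with [u] the distance from the
    death rate to [b], it measures what replacing the rate costs during one step. *)
Definition time_integral (t : R) (u : S -> R) (x : S) : R :=
  \int[lebesgue_measure]_(s in `[0, t]) \int[K (s, x)]_y u y.

Variables (t : R) (u : S -> R).
Hypotheses (t0 : 0 <= t) (bu : bounded_measurable u).

Lemma bounded_measurable_orbit x :
  bounded_measurable (fun s : R => \int[K (s, x)]_y u y).
Proof.
have [mk [C kC]] := bounded_measurable_kernel_Rintegral K bu.
by split; [exact: (measurableT_comp mk (pair2_measurable x))|exists C].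
Qed.

Lemma integrable_itv0 f : bounded_measurable f ->
  (@lebesgue_measure R).-integrable `[0, t]%classic (EFin \o f).
Proof.
move=> bf; apply: bounded_measurable_integrable => //.
by rewrite [X in (X < _)%E](lebesgue_measure_itv0 t0) ltry.
Qed.

Lemma Rintegral_itv0_cst (c : R) :
  \int[lebesgue_measure]_(s in `[0, t]) c = t * c.
Proof.
rewrite Rintegral_cst// (_ : fine _ = t)/= 1?mulrC//.
by rewrite [X in fine X](lebesgue_measure_itv0 t0).
Qed.

Lemma time_integral_bounds c1 c2 x : (forall y, c1 <= u y <= c2) ->
  t * c1 <= time_integral t u x <= t * c2.
Proof.
move=> uc; rewrite -!Rintegral_itv0_cst.
apply/andP; split; apply: le_Rintegral => //;
  do ?[exact: integrable_itv0 (bounded_measurable_orbit x)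
      |apply: integrable_itv0; exact: bounded_measurable_cst].
- by move=> s _; apply: kernel_Rintegral_ge => // y; case/andP: (uc y).
- by move=> s _; apply: kernel_Rintegral_le => // y; case/andP: (uc y).
Qed.

Hypothesis u0 : forall y, 0 <= u y.

(** With the indicator of [0, t] inside the integrand, Tonelli on the whole product gives both the
    measurability in [x] and the exchange with [nu]. *)
Let f (z : R * S) : \bar R := (\1_(`[0, t]%classic) z.1 * \int[K z]_y u y)%:E.

Let mf : measurable_fun setT f.
Proof.
apply/measurable_EFinP; apply: measurable_funM.
  by apply: measurableT_comp => //; exact: measurable_indic.
exact: measurable_kernel_Rintegral.
Qed.

Let f0 z : (0 <= f z)%E.
Proof. by rewrite lee_fin mulr_ge0// Rintegral_ge0. Qed.

Let time_integralE x :
  (time_integral t u x)%:E = (\int[lebesgue_measure]_s f (s, x))%E.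
Proof.
rewrite /time_integral /Rintegral fineK.
  rewrite integral_mkcond; apply: eq_integral => s _.
  rewrite /f/= patchE indicE; by case: ifPn => _; rewrite (mul1r, mul0r).
apply: integrable_fin_num => //.
exact: integrable_itv0 (bounded_measurable_orbit x).
Qed.

Lemma bounded_measurable_time_integral : bounded_measurable (time_integral t u).
Proof.
split; last first.
  have [_ [C uC]] := bu; exists (t * C) => x; rewrite ler_norml -mulrN.
  by apply: time_integral_bounds => y; rewrite -ler_norml.
apply/measurable_EFinP; rewrite (_ : _ \o _ = fubini_G lebesgue_measure f).
  exact: measurable_fun_fubini_tonelli_G.
by apply/funext => x; exact: time_integralE.
Qed.

Lemma invariant_Rintegral (nu : probability S R) g s : invariant_distribution K nu ->
  bounded_measurable g -> 0 <= s ->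
  \int[nu]_x \int[K (s, x)]_y g y = \int[nu]_x g x.
Proof.
move=> inv bg s0; symmetry.
apply: (@Rintegral_mixture _ _ _ _ _ nu (kernel_at K s) _ nu) => //.
  exact: probability_lty.
by move=> A mA; symmetry; exact: inv.
Qed.

Lemma Rintegral_time_integral (nu : probability S R) : invariant_distribution K nu ->
  \int[nu]_x time_integral t u x = t * \int[nu]_x u x.
Proof.
move=> inv; rewrite {1}/Rintegral; under eq_integral do rewrite time_integralE.
rewrite -[X in fine X]/(\int[nu]_x fubini_G lebesgue_measure f x)%E.
have -> : (\int[nu]_x fubini_G lebesgue_measure f x =
    \int[lebesgue_measure]_s fubini_F nu f s)%E by symmetry; exact: fubini_tonelli.
rewrite -Rintegral_itv0_cst.
rewrite -[RHS]/(fine (\int[lebesgue_measure]_(s in `[0%R, t]) (\int[nu]_x u x)%R%:E)%E).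
rewrite [in RHS]integral_mkcond; congr fine; apply: eq_integral => s _.
rewrite /fubini_F/= patchE; case: ifPn => [s0t|s0t].
  rewrite -(invariant_Rintegral inv bu (s := s)); last first.
    by move: s0t; rewrite inE/= in_itv/= => /andP[].
  rewrite fineK; last first.
    apply: integrable_fin_num => //; apply: bounded_measurable_integrable => //.
      exact: probability_lty.
    exact: (bounded_measurable_kernel_Rintegral (kernel_at K s) bu).
  by apply: eq_integral => x _; rewrite /f/= indicE [X in (nat_of_bool X)%:R]s0t mul1r.
rewrite integral0_eq// => x _.
by rewrite /f/= indicE [X in (nat_of_bool X)%:R](negbTE s0t) mul0r.
Qed.

End time_integral.

(** * Test functions *)

Section test_function.
Context d (S : measurableType d) (R : realType) (K : R.-pker (R * S) ~> S).
Variables (lambda b t : R) (psi : S -> R).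

(* The payoff psi, collected at each of at most m steps of length t and until the
   queue empties, for the Euler scheme of the queue with constant death rate b. *)
Definition base_step (f : nat * S -> R) (l : nat) (x : S) : R :=
  let g := frozen_queue K t f in
  g (l.+1, x) + t * (lambda * (g (l.+2, x) - g (l.+1, x)) - b * (g (l.+1, x) - g (l, x))).

Fixpoint test_function (m : nat) (z : nat * S) : R :=
  if m is m'.+1 then
    if z.1 is l.+1 then psi z.2 + base_step (test_function m') l z.2 else 0
  else 0.

Hypotheses (lambda0 : 0 < lambda) (b0 : lambda < b) (t0 : 0 < t).
Hypothesis (tb : t * (lambda + b) <= 1).
Hypotheses (bpsi : bounded_measurable psi) (psi0 : forall x, 0 <= psi x).

Lemma test_function0 m x : test_function m (0%N, x) = 0.
Proof. by case: m. Qed.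

(** When [t * (lambda + b) <= 1] this is a convex combination, hence monotone and bound-preserving;
    this is the reason for that constraint on the mesh. *)
Lemma base_stepE f l x : base_step f l x = let g := frozen_queue K t f in
  t * lambda * g (l.+2, x) + t * b * g (l, x) + (1 - t * (lambda + b)) * g (l.+1, x).
Proof. rewrite /base_step/=; ring. Qed.

Lemma bounded_measurable_test_function m : bounded_measurable (test_function m).
Proof.
elim: m => [|m IH]; first exact: bounded_measurable_cst.
have bg := bounded_measurable_frozen K t IH.
have [[_ [C gC]] [mpsi [D psiD]]] := (bg, bpsi).
have bs l : bounded_measurable (base_step (test_function m) l).
  have bgl j := bounded_measurable_section j bg.
  have bc c := bounded_measurable_cst S (c : R).
  exact: (bounded_measurableD (bgl l.+1) (bounded_measurableM (bc t)
    (bounded_measurableB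
      (bounded_measurableM (bc lambda) (bounded_measurableB (bgl l.+2) (bgl l.+1)))
      (bounded_measurableM (bc b) (bounded_measurableB (bgl l.+1) (bgl l)))))).
split.
  apply: measurable_fun_nat_product => -[|l] /=; first exact: measurable_cst.
  by apply: measurable_funD => //; case: (bs l).
exists (D + C).
have C0 : 0 <= C by apply: le_trans (gC point).
have D0 : 0 <= D by apply: le_trans (psiD point).
case=> -[|l] x; first by rewrite normr0 addr_ge0.
rewrite (le_trans (ler_normD _ _))// lerD// base_stepE/=.
have ge0 : 0 <= t * lambda /\ 0 <= t * b /\ 0 <= 1 - t * (lambda + b).
  have [l0 b0' t0'] : [/\ 0 <= lambda, 0 <= b & 0 <= t].
    by have := (lambda0, b0, t0) => -[[? ?] ?]; split; lra.
  by rewrite !mulr_ge0 ?subr_ge0.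
have [h1 [h2 h3]] := ge0.
have -> : C = t * lambda * C + t * b * C + (1 - t * (lambda + b)) * C by ring.
rewrite (le_trans (ler_normD _ _))// lerD//.
  rewrite (le_trans (ler_normD _ _))// lerD//;
  by rewrite normrM ger0_norm// ler_wpM2l.
by rewrite normrM ger0_norm// ler_wpM2l.
Qed.

Lemma frozen_queue_increment f s B l x : bounded_measurable f ->
  (forall l x, 0 <= f (l.+1, x) - f (l, x) <= B) ->
  0 <= frozen_queue K s f (l.+1, x) - frozen_queue K s f (l, x) <= B.
Proof.
move=> bf fB; rewrite /frozen_queue/= -kernel_RintegralB;
  do ?exact: bounded_measurable_section.
have bi : bounded_measurable (fun y => f (l.+1, y) - f (l, y)).
  by apply: bounded_measurableB; exact: bounded_measurable_section.
by rewrite kernel_Rintegral_ge ?kernel_Rintegral_le// => y;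
  case/andP: (fB l y).
Qed.

(** Away from 0 the payoffs cancel and an increment is a convex combination of earlier ones. At
    [l = 0] the bound [B] must satisfy t Phi + t lambda B + (1 - t b) B = B, whose solution is
    [Phi / (b - lambda)]. *)
Lemma test_function_increment Phi m l x : (forall x, psi x <= t * Phi) ->
  0 <= test_function m (l.+1, x) - test_function m (l, x) <= Phi / (b - lambda).
Proof.
move=> psiPhi.
have bl0 : 0 < b - lambda by rewrite subr_gt0.
have [h1 [h2 h3]] : 0 <= t * lambda /\ 0 <= t * b /\ 0 <= 1 - t * (lambda + b).
  have [l0 b0' t0'] : [/\ 0 <= lambda, 0 <= b & 0 <= t].
    by have := (lambda0, b0, t0) => -[[? ?] ?]; split; lra.
  by rewrite !mulr_ge0 ?subr_ge0.
have Phi0 : 0 <= Phi.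
  by rewrite -(pmulr_rge0 _ t0); apply: le_trans (psi0 x) (psiPhi x).
set B := Phi / (b - lambda).
have PhiE : Phi = B * (b - lambda) by rewrite /B divfK// gt_eqF.
elim: m l x => [|m IH] l x; first by rewrite /= subrr lexx/= divr_ge0// ltW.
have H := frozen_queue_increment t _ _ (bounded_measurable_test_function m) IH.
have H0 : frozen_queue K t (test_function m) (0%N, x) = 0.
  rewrite /frozen_queue/=; under eq_Rintegral do rewrite test_function0.
  by rewrite kernel_Rintegral_cst.
have := psi0 x; have := psiPhi x.
case: l => [|l] /=; rewrite !base_stepE/=.
  have /andP[a1 a2] := H 0%N x; have /andP[a3 a4] := H 1%N x.
  move: H0 a1 a2 a3 a4; set g := frozen_queue _ _ _ => H0.
  rewrite H0 subr0 => a1 a2 a3 a4 p1 p2.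
  apply/andP; split; first nra.
  have -> : psi x + (t * lambda * g (2%N, x) + t * b * 0 +
     (1 - t * (lambda + b)) * g (1%N, x)) - 0 = psi x +
     (t * lambda * (g (2%N, x) - g (1%N, x)) +
      (1 - t * (lambda + b) + t * lambda) * g (1%N, x)) by ring.
  have -> : B = t * Phi + (t * lambda * B +
      (1 - t * (lambda + b) + t * lambda) * B) by rewrite PhiE; ring.
  by rewrite !lerD// ler_wpM2l// addr_ge0.
have /andP[a1 a2] := H l x; have /andP[a3 a4] := H l.+1 x.
have /andP[a5 a6] := H l.+2 x.
move: a1 a2 a3 a4 a5 a6; set g := frozen_queue _ _ _ => a1 a2 a3 a4 a5 a6 _ _.
rewrite [X in 0 <= X <= _](_ : _ = t * lambda * (g (l.+3, x) - g (l.+2, x)) +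
    t * b * (g (l.+1, x) - g (l, x)) +
    (1 - t * (lambda + b)) * (g (l.+2, x) - g (l.+1, x))); last by ring.
apply/andP; split; first by rewrite !addr_ge0// mulr_ge0.
have -> : B = t * lambda * B + t * b * B + (1 - t * (lambda + b)) * B by ring.
by rewrite !lerD// ler_wpM2l.
Qed.

End test_function.

(** * One grid step of the P-Queue compared with one Euler step at constant death rate *)

Section one_step.
Context d (S : measurableType d) (R : realType) (K : R.-pker (R * S) ~> S).
Variables (lambda mu e b : R) (p : S -> R).
Variable Q : R.-pker (R * (nat * S)) ~> (nat * S)%type.
Variables (Rb B : R) (u1 u2 : S -> R) (f : nat * S -> R).
Hypotheses (tK : transition_function K) (HQ : p_queue_transition K lambda mu p e Q).
Hypothesis bp : bounded_measurable p.
Hypothesis lambda0 : 0 <= lambda.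
Hypothesis rate_bound : forall x, `|mu + e * p x| <= Rb.
Hypotheses (bu1 : bounded_measurable u1) (bu2 : bounded_measurable u2).
Hypotheses (u10 : forall x, 0 <= u1 x) (u20 : forall x, 0 <= u2 x).
Hypothesis rate_near : forall x, - u2 x <= mu + e * p x - b <= u1 x.
Hypothesis bf : bounded_measurable f.
Hypothesis fB : forall l x, 0 <= f (l.+1, x) - f (l, x) <= B.
Local Notation A := (queue_generator lambda mu p e).

(** As the increments of [g] lie in [0, B], the sign of the rate deviation passes to the error.
    Separate [u1] and [u2] allow either of them to be zero, which is how one-sided bounds arise. *)
Lemma generator_near g l x : (forall l x, 0 <= g (l.+1, x) - g (l, x) <= B) ->
  let c := lambda * (g (l.+2, x) - g (l.+1, x)) - b * (g (l.+1, x) - g (l, x)) in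
  c - B * u1 x <= A g (l.+1, x) <= c + B * u2 x.
Proof.
move=> gB /=.
have /andP[r2 r1] := rate_near x.
have /andP[g0 g1] := gB l x.
set c := lambda * _.
have -> : c + (mu + e * p x) * (g (l, x) - g (l.+1, x)) =
  (c - b * (g (l.+1, x) - g (l, x))) - (mu + e * p x - b) * (g (l.+1, x) - g (l, x)).
  by ring.
move: r2 r1 g0 g1; set r := mu + e * p x - b; set i := g _ - g _ => r2 r1 g0 g1.
have v1 := u10 x; have v2 := u20 x.
rewrite lerD2l lerN2 lerD2l; apply/andP; split.
  by rewrite (le_trans (ler_wpM2r g0 r1))// mulrC ler_wpM2r.
rewrite -mulNr mulrC (le_trans (_ : _ <= i * u2 x))//.
  by rewrite ler_wpM2l// lerNl.
by rewrite ler_wpM2r.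
Qed.

(** In the variation of constants formula, replacing Q_s by K_s costs O(s), hence O(t^2) after
    integration: this is [C]. Replacing the death rate by [b] under K_s costs [B] times the mean of
    [u1] or [u2] at time [s], which integrates to [time_integral]. *)
Lemma transition_near t l x : 0 <= t ->
  let E := base_step K lambda b t f l x in
  let C := t * (t * ((lambda + Rb) * (2 * ((lambda + Rb) * B)))) in
  E - B * time_integral K t u1 x - C <= \int[Q (t, (l.+1, x))]_y f y
    <= E + B * time_integral K t u2 x + C.
Proof.
move=> t0 /=.
have [mf [Cf fC]] := bf.
rewrite HQ//; last by exists Cf.
rewrite /base_step; set g := frozen_queue K t f.
set D := lambda * (g (l.+2, x) - g (l.+1, x)) - b * (g (l.+1, x) - g (l, x)).
set C := t * ((lambda + Rb) * (2 * ((lambda + Rb) * B))).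
set G := fun s => \int[Q (s, (l.+1, x))]_y A (frozen_queue K (t - s) f) y.
have GB s : 0 <= s <= t -> D - C - B * \int[K (s, x)]_y u1 y <= G s
    <= D + C + B * \int[K (s, x)]_y u2 y.
  move=> /andP[s0 st]; have ts0 : 0 <= t - s by rewrite subr_ge0.
  set k := frozen_queue K (t - s) f.
  have bk : bounded_measurable k by exact: bounded_measurable_frozen.
  have kB l' x' : 0 <= k (l'.+1, x') - k (l', x') <= B.
    exact: frozen_queue_increment.
  have bA := bounded_measurable_generator lambda mu e bp bk.
  have AB y : `|A k y| <= (lambda + Rb) * B.
    apply: generator_bound => // l' x'.
    by case/andP: (kB l' x') => h1 h2; rewrite ger0_norm.
  have := transition_frozen_dist bp lambda0 rate_bound HQ (l.+1, x) bA AB s0.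
  rewrite -/(G s) ler_norml => /andP[].
  have sC : s * ((lambda + Rb) * (2 * ((lambda + Rb) * B))) <= C.
    apply: ler_wpM2r => //.
    have Rb0 : 0 <= Rb by apply: le_trans (rate_bound point).
    have B0 : 0 <= B by case/andP: (fB 0%N point) => h1 /(le_trans h1).
    by rewrite !mulr_ge0// addr_ge0.
  have bkl j : bounded_measurable (fun y => k (j, y)) by exact: bounded_measurable_section.
  have bD : bounded_measurable (fun y =>
     lambda * (k (l.+2, y) - k (l.+1, y)) - b * (k (l.+1, y) - k (l, y))).
    exact: (bounded_measurableB
      (bounded_measurableM (bounded_measurable_cst _ _) (bounded_measurableB (bkl l.+2) (bkl l.+1)))
      (bounded_measurableM (bounded_measurable_cst _ _) (bounded_measurableB (bkl l.+1) (bkl l)))).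
  have bBu u : bounded_measurable u -> bounded_measurable (fun y : S => B * u y).
    by move=> bu; apply: bounded_measurableM => //; exact: bounded_measurable_cst.
  (* With a constant rate the queue part commutes with the motion of X, and K_s K_{t-s} = K_t makes
     the result independent of [s]. *)
  have DE : \int[K (s, x)]_y (lambda * (k (l.+2, y) - k (l.+1, y)) -
      b * (k (l.+1, y) - k (l, y))) = D.
    rewrite kernel_RintegralB; do 2?[apply: bounded_measurableM;
      [exact: bounded_measurable_cst|exact: bounded_measurableB]].
    rewrite !kernel_RintegralZ ?kernel_RintegralB//; try exact: bounded_measurableB.
    have kg j : \int[K (s, x)]_y k (j, y) = g (j, x).
      have := frozen_queueD (j, x) tK bf s0 ts0.
      by rewrite [s + _]addrC subrK.
    by rewrite !kg.
  have lo : D - B * \int[K (s, x)]_y u1 y <= frozen_queue K s (A k) (l.+1, x).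
    rewrite -DE -kernel_RintegralZ// -kernel_RintegralB//; last exact: bBu.
    apply: le_kernel_Rintegral.
    - by apply: bounded_measurableB => //; exact: bBu.
    - exact: (bounded_measurable_section l.+1 bA).
    - by move=> y; case/andP: (generator_near l y kB).
  have hi : frozen_queue K s (A k) (l.+1, x) <= D + B * \int[K (s, x)]_y u2 y.
    rewrite -DE -kernel_RintegralZ// -kernel_RintegralD//; last exact: bBu.
    apply: le_kernel_Rintegral.
    - exact: (bounded_measurable_section l.+1 bA).
    - by apply: bounded_measurableD => //; exact: bBu.
    - by move=> y; case/andP: (generator_near l y kB).
  move=> lo' hi'; apply/andP; split; lra.
have bo u : bounded_measurable u -> bounded_measurable (fun s => \int[K (s, x)]_y u y).
  by move=> bu; exact: bounded_measurable_orbit.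
have bc (c : R) u : bounded_measurable u ->
    bounded_measurable (fun s => c * \int[K (s, x)]_y u y).
  by move=> bu; apply: bounded_measurableM; [exact: bounded_measurable_cst|exact: bo].
have GB1 s : `[0, t]%classic s -> D - C - B * \int[K (s, x)]_y u1 y <= G s.
  by rewrite /= in_itv/= => /GB /andP[].
have GB2 s : `[0, t]%classic s -> G s <= D + C + B * \int[K (s, x)]_y u2 y.
  by rewrite /= in_itv/= => /GB /andP[].
have [c1 c1E] : exists c, c = D - C by eexists.
have [c2 c2E] : exists c, c = D + C by eexists.
rewrite -c1E in GB1; rewrite -c2E in GB2.
have := @le_Rintegral_nonmeasurable _ _ _ (@lebesgue_measure R) `[0, t]%classic
  (fun s => c1 - B * \int[K (s, x)]_y u1 y) G
  (fun s => c2 + B * \int[K (s, x)]_y u2 y) (measurable_itv _)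
  (integrable_itv0 t0 (bounded_measurableB (bounded_measurable_cst _ c1) (bc B _ bu1)))
  (integrable_itv0 t0 (bounded_measurableD (bounded_measurable_cst _ c2) (bc B _ bu2))) GB1 GB2.
rewrite RintegralB//; last 2 first.
  exact: (integrable_itv0 t0 (bounded_measurable_cst _ _)).
  exact: (integrable_itv0 t0 (bc B _ bu1)).
rewrite RintegralD//; last 2 first.
  exact: (integrable_itv0 t0 (bounded_measurable_cst _ _)).
  exact: (integrable_itv0 t0 (bc B _ bu2)).
rewrite !RintegralZl//;
  try solve [exact: (integrable_itv0 t0 (bo _ bu1))|exact: (integrable_itv0 t0 (bo _ bu2))].
rewrite !(Rintegral_itv0_cst t0) -/(time_integral K t u1 x) -/(time_integral K t u2 x).
move: (time_integral K t u1 x) (time_integral K t u2 x) (Rintegral _ _ _) => v1 v2 I /andP[lo hi].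
rewrite c1E (mulrBr t D C) in lo; rewrite c2E (mulrDr t D C) in hi.
clearbody D C.
by apply/andP; split; lra.
Qed.

End one_step.

(** * The killed random walk behind the test functions *)

Section walk.
Context (R : realType) (a c : R).

(* Mean lifetime, truncated at m steps, of the walk on nat that moves up with
   probability a, down with probability c, and is killed at 0. *)
Fixpoint walk_lifetime (m l : nat) : R :=
  if m is m'.+1 then
    if l is l'.+1 then
      1 + (a * walk_lifetime m' l.+1 + c * walk_lifetime m' l' +
           (1 - (a + c)) * walk_lifetime m' l)
    else 0
  else 0.

Hypotheses (a0 : 0 < a) (ac : a < c) (ac1 : a + c <= 1).
Local Notation e := walk_lifetime.

Lemma walk_lifetime0 m : e m 0 = 0. Proof. by case: m. Qed.

Let hyps : [/\ 0 < a, a < c, a + c <= 1, 0 < c - a & 0 <= 1 - (a + c)].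
Proof. by have := (a0, ac, ac1) => -[[? ?] ?]; split; lra. Qed.

Lemma walk_lifetime_increment m l : 0 <= e m l.+1 - e m l <= (c - a)^-1.
Proof.
have [h1 h2 h3 h4 h5] := hyps.
set B := (c - a)^-1.
have B0 : 0 <= B by rewrite invr_ge0 ltW.
have BE : 1 = B * (c - a) by rewrite mulVf// gt_eqF.
have c0 : 0 <= c by lra.
elim: m l => [|m IH] l; first by rewrite /= subrr lexx.
case: l => [|l].
  have /andP[w0 w1] := IH 0%N; have /andP[w2 w3] := IH 1%N.
  move: w0 w1 w2 w3; rewrite /= walk_lifetime0 !subr0 mulr0 addr0.
  move: (e m 1) (e m 2) => x y w0 w1 w2 w3.
  have -> : 1 + (a * y + (1 - (a + c)) * x) = 1 + (a * (y - x) + (1 - c) * x) by ring.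
  have c1 : 0 <= 1 - c by lra.
  have -> : B = 1 + (a * B + (1 - c) * B) by rewrite [X in X + _]BE; ring.
  have a0' : 0 <= a by lra.
  apply/andP; split; first by rewrite !addr_ge0// mulr_ge0.
  by rewrite lerD2l lerD// ler_wpM2l.
have /andP[w0 w1] := IH l; have /andP[w2 w3] := IH l.+1.
have /andP[w4 w5] := IH l.+2.
move: w0 w1 w2 w3 w4 w5 => /=.
move: (e m l) (e m l.+1) (e m l.+2) (e m l.+3) => x y z w w0 w1 w2 w3 w4 w5.
rewrite [X in 0 <= X <= _](_ : _ = a * (w - z) + c * (y - x) + (1 - (a + c)) * (z - y));
  last by ring.
have a0' : 0 <= a by lra.
have -> : B = a * B + c * B + (1 - (a + c)) * B by ring.
apply/andP; split; first by rewrite !addr_ge0// mulr_ge0.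
by rewrite !lerD// ler_wpM2l.
Qed.

Lemma walk_lifetime_nondecreasing l : nondecreasing_seq (e ^~ l).
Proof.
have [h1 h2 h3 h4 h5] := hyps.
have c0 : 0 <= c by lra.
apply/nondecreasing_seqP => m; elim: m l => [|m IH] [|l] //=.
  by rewrite !mulr0 !addr0 ler01.
by rewrite lerD2l !lerD// ler_wpM2l// ?ltW//; exact: IH.
Qed.

(** This bound, valid for every truncation, is all that the upper estimate of the busy period uses;
    the exact limit below serves the lower estimate. *)
Lemma walk_lifetime_le m l : e m l <= l%:R * (c - a)^-1.
Proof.
elim: l => [|l IH]; first by rewrite walk_lifetime0 mul0r.
have /andP[_] := walk_lifetime_increment m l.
move: IH; rewrite -natr1 mulrDl mul1r => h k.
by have := lerD k h; rewrite subrK addrC.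
Qed.

Lemma is_cvg_walk_lifetime l : cvgn (e ^~ l).
Proof.
apply: nondecreasing_is_cvgn; first exact: walk_lifetime_nondecreasing.
by exists (l%:R * (c - a)^-1) => _ [m _ <-]; exact: walk_lifetime_le.
Qed.

(* The deviation of the increments from (c - a)^-1 grows geometrically in l,
   while it stays bounded: it vanishes. *)
Lemma cvg_walk_lifetime1 : e ^~ 1%N @ \oo --> (c - a)^-1.
Proof.
have [h1 h2 h3 h4 h5] := hyps.
set B := (c - a)^-1.
have BE : B * (c - a) = 1 by rewrite mulVf// gt_eqF.
pose f l := limn (e ^~ l).
have ef l : e ^~ l @ \oo --> f l by exact: is_cvg_walk_lifetime.
have f0 : f 0%N = 0.
  by apply/cvg_lim => //; under eq_fun do rewrite walk_lifetime0; exact: cvg_cst.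
have fE l : f l.+1 = 1 + (a * f l.+2 + c * f l + (1 - (a + c)) * f l.+1).
  have E1 : (fun m => e m.+1 l.+1) @ \oo --> f l.+1.
    by rewrite (cvg_shiftS (e ^~ l.+1)).
  transitivity (limn (fun m => e m.+1 l.+1)); first by symmetry; exact: cvg_lim E1.
  apply: cvg_lim => //=.
  exact: (cvgD (cvg_cst (1 : R)) (cvgD (cvgD (cvgM (cvg_cst a) (ef l.+2))
    (cvgM (cvg_cst c) (ef l))) (cvgM (cvg_cst (1 - (a + c))) (ef l.+1)))).
have v_bound l : 0 <= B - (f l.+1 - f l) <= B.
  rewrite lerBlDr lerDl subr_ge0 -subr_ge0 andbC.
  have ei : (fun m => e m l.+1 - e m l) @ \oo --> f l.+1 - f l by exact: cvgB.
  apply/andP; split.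
    by apply: (cvgr_to_ge ei); apply: nearW => m; case/andP: (walk_lifetime_increment m l).
  rewrite subr_ge0; apply: (cvgr_to_le ei); apply: nearW => m.
  by case/andP: (walk_lifetime_increment m l).
pose v l := B - (f l.+1 - f l).
have vS l : a * v l.+1 = c * v l.
  rewrite /v; have := fE l; move: (f l.+2) (f l.+1) (f l) BE => z y x BE' E.
  have -> : a * (B - (z - y)) = a * B - (a * z) + a * y by ring.
  have -> : a * z = c * (y - x) + a * y - 1 by lra.
  have -> : c * (B - (y - x)) = B * (c - a) + a * B - c * (y - x) by ring.
  by rewrite BE'; ring.
(* [v] is multiplied by [c / a > 1] at each step. The linear minorant of its powers (Bernoulli) is
   enough to contradict boundedness. *)
have vgrow l : v 0%N * (1 + l%:R * ((c - a) / a)) <= v l.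
  have v0 : 0 <= v 0%N by case/andP: (v_bound 0%N).
  elim: l => [|l IH]; first by rewrite mul0r addr0 mulr1.
  have k0 : 0 <= (c - a) / a by rewrite divr_ge0// ltW.
  have -> : v l.+1 = v l + (c - a) / a * v l.
    have -> : v l.+1 = (c * v l) / a by rewrite -vS mulrAC divff ?mul1r// gt_eqF.
    by field; rewrite gt_eqF.
  have -> : v 0%N * (1 + l.+1%:R * ((c - a) / a)) =
    v 0%N * (1 + l%:R * ((c - a) / a)) + (c - a) / a * v 0%N.
    by rewrite -natr1; ring.
  rewrite lerD// ler_wpM2l//; apply: le_trans IH.
  by rewrite ler_peMr// lerDl mulr_ge0.
have v00 : v 0%N = 0.
  apply/eqP; rewrite eq_le; case/andP: (v_bound 0%N) => v0 _.
  rewrite v0 andbT leNgt; apply/negP => v0p.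
  have k0 : 0 < (c - a) / a by rewrite divr_gt0.
  have vk0 : 0 < v 0%N * ((c - a) / a) by rewrite mulr_gt0.
  have B0 : 0 <= B by rewrite invr_ge0 ltW.
  have := archi_boundP (divr_ge0 B0 (ltW vk0)).
  set n := Num.bound _; rewrite ltr_pdivrMr// => Bn.
  have := vgrow n; have /andP[_] := v_bound n.
  rewrite -/(v n); move: (v n) => w wB vw.
  have := le_lt_trans (le_trans vw wB) Bn.
  by rewrite mulrDr mulr1 mulrCA gtrDr ltNge (ltW v0p).
have <- : f 1%N = B by move: v00; rewrite /v f0 subr0 => /eqP; rewrite subr_eq0 => /eqP.
exact: ef.
Qed.

End walk.

Section integrated_test_function.
Context d (S : measurableType d) (R : realType) (K : R.-pker (R * S) ~> S).
Variables (nu : probability S R) (lambda b t : R) (psi : S -> R).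
Hypotheses (lambda0 : 0 < lambda) (b0 : lambda < b) (t0 : 0 < t).
Hypothesis (tb : t * (lambda + b) <= 1).
Hypothesis bpsi : bounded_measurable psi.
Hypothesis inv : invariant_distribution K nu.

Lemma probability_integrable (g : S -> R) : bounded_measurable g ->
  nu.-integrable setT (EFin \o g).
Proof.
by move=> bg; apply: bounded_measurable_integrable => //; exact: probability_lty.
Qed.

(** Since [b] does not depend on x, integrating the recursion against [nu] removes every K_t by
    invariance and leaves the recursion of the walk with up and down probabilities [t * lambda] and
    [t * b]. *)
Lemma Rintegral_test_function m l :
  \int[nu]_x test_function K lambda b t psi m (l, x) =
  walk_lifetime (t * lambda) (t * b) m l * \int[nu]_x psi x.
Proof.
elim: m l => [|m IH] [|l] /=; rewrite ?Rintegral_cst ?mul0r//.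
under eq_Rintegral do rewrite base_stepE/=.
have bt := bounded_measurable_test_function K lambda0 b0 t0 tb bpsi m.
have bg j := bounded_measurable_section j (bounded_measurable_frozen K t bt).
have bZ (r : R) j := bounded_measurableM (bounded_measurable_cst S r) (bg j).
have gE j : \int[nu]_x frozen_queue K t (test_function K lambda b t psi m) (j, x) =
    walk_lifetime (t * lambda) (t * b) m j * \int[nu]_x psi x.
  rewrite -IH; exact: (invariant_Rintegral inv (bounded_measurable_section j bt) (ltW t0)).
have b1 := bounded_measurableD (bZ (t * lambda) l.+2) (bZ (t * b) l).
have b2 := bounded_measurableD b1 (bZ (1 - t * (lambda + b)) l.+1).
rewrite !(RintegralD, RintegralZl)//; try exact: probability_integrable.
by rewrite !gE; ring.
Qed.

End integrated_test_function.

(** * The queue observed on a grid *)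

Section restricted_measure.
Context d (W : measurableType d) (R : realType) (P : probability W R).
Variables (F : set W) (mF : measurable F).

Lemma mrestr_setC : mrestr P mF (~` F) = 0%E.
Proof. by rewrite /mrestr setICl measure0. Qed.

Lemma mrestr_lty : (mrestr P mF setT < +oo)%E.
Proof.
rewrite /mrestr setTI (le_lt_trans (probability_le1 P mF))//.
exact: ltry.
Qed.

Lemma integral_mrestr_domain (f : W -> \bar R) :
  (\int[mrestr P mF]_(w in F) f w = \int[P]_(w in F) f w)%E.
Proof.
apply: eq_measure_integral => A mA AF.
by rewrite /= /mrestr; congr (P _); exact/setIidPl.
Qed.

Lemma ge0_integral_mrestr (f : W -> \bar R) : measurable_fun setT f ->
  (forall w, 0 <= f w)%E ->
  (\int[mrestr P mF]_w f w = \int[P]_(w in F) f w)%E.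
Proof.
move=> mf f0; rewrite (@ge0_negligible_integral _ _ _ (mrestr P mF) _ (~` F))//.
- by rewrite setTD setCK integral_mrestr_domain.
- exact: measurableC.
- exact: mrestr_setC.
Qed.

Lemma Rintegral_mrestr (f : W -> R) : bounded_measurable f ->
  \int[mrestr P mF]_w f w = \int[P]_(w in F) f w.
Proof.
move=> bf; rewrite /Rintegral (@negligible_integral _ _ _ (mrestr P mF) _ (~` F))//.
- by rewrite setTD setCK integral_mrestr_domain.
- exact: measurableC.
- by apply: bounded_measurable_integrable => //; exact: mrestr_lty.
- exact: mrestr_setC.
Qed.

Section pushforward.
Context d' (E : measurableType d') (phi : W -> E).
Hypothesis mphi : measurable_fun setT phi.

Lemma bounded_measurable_comp (g : E -> R) : bounded_measurable g ->
  bounded_measurable (fun w => g (phi w)).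
Proof.
move=> [mg [C gC]]; split; last by exists C.
exact: measurableT_comp mg mphi.
Qed.

(** The sub-probability law of [phi] on the event [F]. In these terms the Markov property says that
    the law of Z_{s+t} on [F] is a mixture, so [Rintegral_mixture] extends it from sets to
    functions. *)
Definition restricted_law : {measure set E -> \bar R}.
Proof. by refine (pushforward (mrestr P mF) phi). Defined.

Lemma Rintegral_restricted_law (g : E -> R) : bounded_measurable g ->
  \int[restricted_law]_y g y = \int[P]_(w in F) g (phi w).
Proof.
move=> bg; rewrite -(Rintegral_mrestr (bounded_measurable_comp bg)) /Rintegral.
rewrite integral_pushforward//.
- by apply/measurable_EFinP; case: bg.
- rewrite preimage_setT; apply: bounded_measurable_integrable => //.
    exact: mrestr_lty.
  exact: bounded_measurable_comp.
Qed.

Lemma ge0_integral_restricted_law (g : E -> \bar R) : measurable_fun setT g ->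
  (forall y, 0 <= g y)%E ->
  (\int[restricted_law]_y g y = \int[P]_(w in F) g (phi w))%E.
Proof.
move=> mg g0.
rewrite -[RHS](ge0_integral_mrestr (measurableT_comp mg mphi) (fun w => g0 (phi w))).
by rewrite (ge0_integral_pushforward mphi)// => y _; exact: g0.
Qed.

End pushforward.

End restricted_measure.

Section markov.
Context d d' (W : measurableType d) (E : measurableType d') (R : realType).
Variables (P : probability W R) (Z : R -> W -> E) (Q : R.-pker (R * E) ~> E).
Hypothesis mp : markov_process P Z Q.

Lemma history_measurable s F : 0 <= s -> history Z s F -> measurable F.
Proof.
move=> s0; apply: smallest_sub; first exact: sigma_algebra_measurable.
move=> A [u /= /andP[u0 us] [B mB <-]].
by have [mZ _] := mp; exact: mZ.
Qed.

Lemma markov_Rintegral s t F f : 0 <= s -> 0 <= t -> history Z s F ->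
  bounded_measurable f ->
  \int[P]_(w in F) f (Z (s + t) w) = \int[P]_(w in F) \int[Q (t, Z s w)]_y f y.
Proof.
move=> s0 t0 hF bf; have mF := history_measurable s0 hF.
have [mZ mE] := mp.
have mZs := mZ s s0; have mZst := mZ _ (addr_ge0 s0 t0).
have bQ := bounded_measurable_kernel_Rintegral (kernel_at Q t) bf.
rewrite -(Rintegral_restricted_law P mF mZst bf) -(Rintegral_restricted_law P mF mZs bQ).
apply: Rintegral_mixture => //; first exact: mrestr_lty.
move=> A mA; have mQA := measurable_kernel (kernel_at Q t) A mA.
rewrite ge0_integral_restricted_law//.
by rewrite -mE// /restricted_law/= /pushforward /mrestr setIC.
Qed.

End markov.

Section nonempty_upto.
Context (R : realType) (W : Type).
Variables (L : R -> W -> nat) (t : R).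

Definition nonempty_upto (k : nat) : set W :=
  [set w | forall j, (j <= k)%N -> L (j%:R * t) w <> 0%N].

Lemma nonempty_uptoS k :
  nonempty_upto k.+1 = nonempty_upto k `&` [set w | L (k.+1%:R * t) w <> 0%N].
Proof.
apply/seteqP; split => w /=.
  by move=> h; split; [move=> j jk; apply: h; exact: leqW|exact: h].
by move=> [h hk] j; rewrite leq_eqVlt => /predU1P[->//|]; exact: h.
Qed.

Lemma nonempty_upto0 : nonempty_upto 0 = [set w | L 0 w <> 0%N].
Proof.
apply/seteqP; split => w /= => [/(_ 0%N)|h j]; first by rewrite mul0r; exact.
by rewrite leqn0 => /eqP ->; rewrite mul0r.
Qed.

End nonempty_upto.

Section grid_survival.
Context d (S : measurableType d) (R : realType) d' (W : measurableType d').
Variables (P : probability W R) (L : R -> W -> nat) (X : R -> W -> S).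
Variables (nu : probability S R) (Q : R.-pker (R * (nat * S)) ~> (nat * S)%type).
Let Z s w := (L s w, X s w).
Hypothesis mp : markov_process P Z Q.
Variable t : R.
Hypothesis t0 : 0 <= t.
Local Notation nonempty_upto := (nonempty_upto L t).

Lemma history_nonempty_upto k : history Z (k%:R * t) (nonempty_upto k).
Proof.
have mN : measurable [set z : nat * S | z.1 <> 0%N].
  rewrite (_ : [set _ | _] = [set l : nat | l <> 0%N] `*` setT); first exact: measurableX.
  by apply/seteqP; split => // z /= [].
have hL s : 0 <= s <= k%:R * t -> history Z (k%:R * t) [set w | L s w <> 0%N].
  move=> hs; apply: sub_gen_smallest; exists s => //.
  by exists [set z : nat * S | z.1 <> 0%N] => //; rewrite setTI.
suff : forall k', (k' <= k)%N -> history Z (k%:R * t) (nonempty_upto k') by apply.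
elim=> [_|k' IH k'k].
  by rewrite nonempty_upto0; apply: hL; rewrite lexx mulr_ge0.
rewrite nonempty_uptoS.
apply: (@measurableI _ (g_sigma_algebraType _)); first exact: IH (ltnW k'k).
by apply: hL; rewrite mulr_ge0//= ler_wpM2r// ler_nat.
Qed.

Lemma measurable_nonempty_upto k : measurable (nonempty_upto k).
Proof.
by apply: (history_measurable mp _ (@history_nonempty_upto k)); rewrite mulr_ge0.
Qed.

Variable F : nat -> nat * S -> R.
Hypothesis F_bounded : forall m, bounded_measurable (F m).
Hypothesis F_empty : forall m x, F m (0%N, x) = 0.
Hypothesis F_init : forall z, F 0%N z = 0.

Let F_mean k m := \int[P]_(w in nonempty_upto k) F m (Z (k%:R * t) w).

Let mZ s : 0 <= s -> measurable_fun setT (Z s).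
Proof. by have [mZ _] := mp; exact: mZ. Qed.

(** [F] vanishes when the queue is empty, so nonemptiness at time (k + 1) t need not be imposed. The
    event that remains belongs to the history at time k t, where the Markov property applies. *)
Let F_meanS k m : F_mean k.+1 m =
  \int[P]_(w in nonempty_upto k) \int[Q (t, Z (k%:R * t) w)]_y F m y.
Proof.
have kt0 : 0 <= k%:R * t by rewrite mulr_ge0.
rewrite -(markov_Rintegral mp kt0 t0 (@history_nonempty_upto k) (F_bounded m)).
have -> : k%:R * t + t = k.+1%:R * t by rewrite -natr1 mulrDl mul1r.
rewrite /F_mean nonempty_uptoS Rintegral_mkcondr; apply: eq_Rintegral => w _.
rewrite patchE; case: ifPn => // /negP; rewrite inE/= => /contrapT L0.
by rewrite /Z L0 F_empty.
Qed.

Let law_integrable k f : bounded_measurable f ->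
  P.-integrable (nonempty_upto k) (EFin \o f).
Proof.
move=> bf; apply: bounded_measurable_integrable => //.
  exact: measurable_nonempty_upto.
rewrite (le_lt_trans (probability_le1 P (measurable_nonempty_upto k)))//.
exact: ltry.
Qed.

Let F_law_integrable k m :
  P.-integrable (nonempty_upto k) (EFin \o (fun w => F m (Z (k%:R * t) w))).
Proof.
by apply: law_integrable; apply: bounded_measurable_comp => //; apply: mZ; rewrite mulr_ge0.
Qed.

Let QF_bounded k m :
  bounded_measurable (fun w => \int[Q (t, Z (k%:R * t) w)]_y F m y).
Proof.
exact: (bounded_measurable_comp (mZ (mulr_ge0 (ler0n R k) t0))
  (bounded_measurable_kernel_Rintegral (kernel_at Q t) (F_bounded m))).
Qed.

Definition survival k : R := fine (P (nonempty_upto k)).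

Let Rintegral_survival k (c : R) : \int[P]_(w in nonempty_upto k) c = c * survival k.
Proof. by rewrite Rintegral_cst//; exact: measurable_nonempty_upto. Qed.

Let cst_law_integrable k (c : R) :
  P.-integrable (nonempty_upto k) (EFin \o (fun=> c)).
Proof. by apply: law_integrable; exact: bounded_measurable_cst. Qed.

Let F_mean0 k : F_mean k 0 = 0.
Proof.
rewrite /F_mean; under eq_Rintegral do rewrite F_init.
by rewrite Rintegral_survival mul0r.
Qed.

Hypothesis L0 : {ae P, forall w, L 0 w = 1%N}.
Hypothesis X0 : forall A, measurable A -> P (X 0 @^-1` A) = nu A.

Let F_mean_init m : F_mean 0 m = \int[nu]_x F m (1%N, x).
Proof.
have mL0 : measurable_fun setT (Z 0) by exact: mZ.
have mX : measurable_fun setT (X 0).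
  exact: (measurableT_comp (measurable_snd : measurable_fun setT (@snd nat S)) mL0).
have bF1 : bounded_measurable (fun x => F m (1%N, x)).
  exact: bounded_measurable_section.
transitivity (\int[P]_w F m (1%N, X 0 w)).
  rewrite /F_mean mul0r Rintegral_mkcond /Rintegral; congr fine.
  apply: ae_eq_integral => //.
  - apply/measurable_EFinP.
    apply/(measurable_restrict _ (measurable_nonempty_upto 0) measurableT).1.
    apply: measurable_funTS.
    by case: (bounded_measurable_comp mL0 (F_bounded m)).
  - by apply/measurable_EFinP; case: (bounded_measurable_comp mX bF1).
  - apply: filterS L0 => w Lw _; rewrite patchE ifT ?/Z ?Lw//.
    by rewrite nonempty_upto0 inE/= Lw.
rewrite -(Rintegral_restricted_law P measurableT mX bF1).
rewrite /Rintegral; congr fine; apply: eq_measure_integral => A mA _.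
transitivity (P (X 0 @^-1` A)); last exact: X0.
by rewrite /restricted_law/= /pushforward /mrestr setIT.
Qed.

(** A discrete Dynkin formula. Each step trades one remaining step [m] for one elapsed step [k] and
    pays [D] on the event of survival; the sum telescopes from (0, n) to (n, 0), where [F 0] is
    zero. *)
Lemma survival_sum_ge (D : R) :
  (forall m l x, F m.+1 (l.+1, x) - D <= \int[Q (t, (l.+1, x))]_y F m y) ->
  forall n, \int[nu]_x F n (1%N, x) <= D * \sum_(k < n) survival k.
Proof.
move=> HD n.
have step k m : F_mean k m.+1 <= F_mean k.+1 m + D * survival k.
  rewrite F_meanS -Rintegral_survival -RintegralD//;
    do ?[exact: measurable_nonempty_upto|exact: law_integrable].
  apply: le_Rintegral.
  - exact: measurable_nonempty_upto.
  - exact: F_law_integrable.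
  - exact: (law_integrable k (bounded_measurableD (QF_bounded k m) (bounded_measurable_cst _ D))).
  (* On the event of survival the queue length at time k t is a successor, the only case covered by
     [HD]. *)
  - move=> w /(_ k (leqnn k)); rewrite /Z.
    case: (L _ w) => // l _; rewrite -lerBlDr; exact: HD.
rewrite -F_mean_init.
suff H : forall k m, F_mean 0 (k + m) <= F_mean k m + D * \sum_(j < k) survival j.
  by have := H n 0%N; rewrite addn0 F_mean0 add0r.
elim=> [|k IH] m; first by rewrite add0n big_ord0 mulr0 addr0.
rewrite addSnnS; apply: (le_trans (IH _)); rewrite big_ord_recr/= mulrDr.
by have := step k m; lra.
Qed.

Lemma survival_sum_le (D : R) :
  (forall m l x, \int[Q (t, (l.+1, x))]_y F m y <= F m.+1 (l.+1, x) - D) ->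
  forall n, D * \sum_(k < n) survival k <= \int[nu]_x F n (1%N, x).
Proof.
move=> HD n.
have step k m : F_mean k.+1 m + D * survival k <= F_mean k m.+1.
  rewrite F_meanS -Rintegral_survival -RintegralD//;
    do ?[exact: measurable_nonempty_upto|exact: law_integrable].
  apply: le_Rintegral.
  - exact: measurable_nonempty_upto.
  - exact: (law_integrable k (bounded_measurableD (QF_bounded k m) (bounded_measurable_cst _ D))).
  - exact: F_law_integrable.
  - move=> w /(_ k (leqnn k)); rewrite /Z.
    case: (L _ w) => // l _; rewrite -lerBrDr; exact: HD.
rewrite -F_mean_init.
suff H : forall k m, F_mean k m + D * \sum_(j < k) survival j <= F_mean 0 (k + m).
  by have := H n 0%N; rewrite addn0 F_mean0 add0r.
elim=> [|k IH] m; first by rewrite add0n big_ord0 mulr0 addr0.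
rewrite addSnnS; apply: le_trans (IH _); rewrite big_ord_recr/= mulrDr.
by have := step k m; lra.
Qed.

End grid_survival.

(** * Approximation of the busy period by exit times on grids *)

Section grid_exit.
Context (R : realType) (W : Type) (L : R -> W -> nat).

(* The first k%:R * t at which L vanishes, as the sum of the lengths t of the
   cells preceding it. *)
Definition grid_exit (t : R) (w : W) : \bar R :=
  (\sum_(k <oo) (t * \1_(nonempty_upto L t k) w)%:E)%E.

Lemma grid_exit_le t j w : 0 <= t -> L (j%:R * t) w = 0%N ->
  (grid_exit t w <= (j%:R * t)%:E)%E.
Proof.
move=> t0 Lj; apply: lime_le.
  by apply: is_cvg_nneseries => n _ _; rewrite lee_fin mulr_ge0.
apply: nearW => n; rewrite big_mkord sumEFin lee_fin.
(* The subtraction [j - n] is truncated: the remainder is the part of [0, j t] not covered by the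
   first [n] cells, and it is 0 once [n >= j]. *)
have -> : j%:R * t = \sum_(k < n) (if (k < j)%N then t else 0) + (j - n)%:R * t.
  elim: n => [|n IH]; first by rewrite big_ord0 add0r subn0.
  rewrite big_ord_recr/=; case: ltnP => nj.
    by rewrite IH -(subnSK nj) -natr1; ring.
  by rewrite addr0 IH (eqP nj) (eqP (leqW nj)).
rewrite (@le_trans _ _ (\sum_(k < n) (if (k < j)%N then t else 0)))//; last first.
  by rewrite lerDl mulr_ge0.
apply: ler_sum => k _; rewrite indicE; case: ltnP => kj.
  by rewrite ler_piMr//; case: (_ \in _).
by rewrite memNset ?mulr0// => /(_ j kj).
Qed.

Lemma le_grid_exit t j w : 0 <= t -> (forall i, (i < j)%N -> L (i%:R * t) w <> 0%N) ->
  ((j%:R * t)%:E <= grid_exit t w)%E.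
Proof.
move=> t0 Lj; apply: le_trans (nneseries_lim_ge j _); last first.
  by move=> n _ _; rewrite lee_fin mulr_ge0.
rewrite big_mkord sumEFin lee_fin -[j in leLHS]card_ord -sum1_card natr_sum mulr_suml.
apply: ler_sum => k _; rewrite mul1r indicE mem_set ?mulr1//= => i ik.
by apply: Lj; apply: leq_ltn_trans ik _.
Qed.

Variant grid_exit_spec t w : \bar R -> Prop :=
| GridExit j of L (j%:R * t) w = 0%N : grid_exit_spec t w (j%:R * t)%:E
| NoGridExit of (forall j, L (j%:R * t) w <> 0%N) : grid_exit_spec t w +oo.

Lemma grid_exitP t w : 0 < t -> grid_exit_spec t w (grid_exit t w).
Proof.
move=> t0; have [[j Lj]|/forallNP noexit] := pselect (exists j, L (j%:R * t) w = 0%N).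
  have ex : exists j, L (j%:R * t) w == 0%N by exists j; apply/eqP.
  case: (ex_minnP ex) => m /eqP Lm mmin.
  have -> : grid_exit t w = (m%:R * t)%:E; last exact: GridExit.
  apply/eqP; rewrite eq_le; apply/andP; split; first exact: grid_exit_le (ltW t0) Lm.
  apply: le_grid_exit (ltW t0) _ => i im /eqP.
  by move=> /mmin; rewrite leqNgt im.
have -> : grid_exit t w = +oo%E; last exact: NoGridExit.
apply/eqyP => A A0; apply: le_trans (le_grid_exit (j := Num.bound (A / t)) (ltW t0) _).
  by rewrite lee_fin -ler_pdivrMr// ltW// archi_boundP// divr_ge0// ltW.
by move=> i _; exact: noexit.
Qed.

Lemma busy_period_le_grid_exit t w : 0 < t -> (busy_period L w <= grid_exit t w)%E.
Proof.
move=> t0; case: grid_exitP => // [j Lj|_]; last exact: leey.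
by apply: ereal_inf_lbound; exists (j%:R * t) => //; split => //; rewrite mulr_ge0// ltW.
Qed.

Lemma grid_exit_refine t n w : 0 < t -> (0 < n)%N ->
  (grid_exit (t / n%:R) w <= grid_exit t w)%E.
Proof.
move=> t0 n0; case: (grid_exitP w t0) => [j Lj|_]; last exact: leey.
have jt : (j * n)%:R * (t / n%:R) = j%:R * t :> R.
  by rewrite natrM; field; rewrite pnatr_eq0 -lt0n.
rewrite -jt; apply: grid_exit_le; first by rewrite divr_ge0// ltW.
by rewrite jt.
Qed.

Hypothesis L_right : forall w s, 0 <= s -> \forall u \near s^'+, L u w = L s w.

(** Dyadic grids are nested, so exit times decrease to their infimum. By right continuity a zero of
    L persists for a while, and a fine enough grid meets it shortly afterwards. *)
Lemma cvg_grid_exit t w : 0 < t ->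
  (fun n => grid_exit (t / (2 ^ n)%:R) w) @ \oo --> busy_period L w.
Proof.
move=> t0; have tn0 n : 0 < t / (2 ^ n)%:R by rewrite divr_gt0// ltr0n expn_gt0.
have -> : busy_period L w = ereal_inf [set grid_exit (t / (2 ^ n)%:R) w | n in setT].
  apply/eqP; rewrite eq_le; apply/andP; split.
    by apply: le_ereal_inf_tmp => _ [n _ <-]; exact: busy_period_le_grid_exit.
  apply: le_ereal_inf_tmp => _ [s [s0 Ls] <-].
  apply/lee_addgt0Pr => e e0.
  have := L_right w s0; rewrite Ls => -[h /= h0 hL].
  have m0 : 0 < Num.min h e by rewrite lt_min h0.
  have [n tn] : exists n, t / (2 ^ n)%:R < Num.min h e.
    exists (Num.bound (t / Num.min h e)).
    rewrite ltr_pdivrMr ?ltr0n ?expn_gt0// mulrC -ltr_pdivrMr//.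
    apply: (lt_le_trans (archi_boundP _)); first by rewrite divr_ge0// ltW.
    by rewrite ler_nat ltnW// ltn_expl.
  set tau := t / _ in tn.
  have tau0 : 0 < tau by exact: tn0.
  apply: ge_ereal_inf; exists (grid_exit tau w); first by exists n.
  (* The successor puts the grid point strictly to the right of [s], because the filter [s^'+]
     leaves out [s] itself. *)
  pose j := (Num.truncn (s / tau)).+1.
  have /andP[j1 j2] : s < j%:R * tau <= s + tau.
    have st0 : 0 <= s / tau by rewrite divr_ge0// ltW.
    have /andP[h1 h2] := truncn_itv st0.
    rewrite -ltr_pdivrMr// h2/= /j -natr1 mulrDl mul1r lerD2r.
    by rewrite -ler_pdivlMr.
  have [th te] : tau < h /\ tau < e by move: tn; rewrite lt_min => /andP[].
  apply: (@le_trans _ _ (j%:R * tau)%:E).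
    apply: grid_exit_le; first exact: ltW.
    apply: hL => //=; rewrite ltr_norml; apply/andP; split; lra.
  by rewrite -EFinD lee_fin; lra.
apply: ereal_nonincreasing_cvgn; apply/nonincreasing_seqP => n.
have -> : t / (2 ^ n.+1)%:R = t / (2 ^ n)%:R / 2%:R.
  by rewrite expnSr natrM invfM mulrA.
exact: grid_exit_refine.
Qed.

End grid_exit.

(** * Bounds for the mean busy period *)

Section mean_busy_period.
Context d (S : measurableType d) (R : realType) d' (W : measurableType d').
Variables (K : R.-pker (R * S) ~> S) (nu : probability S R).
Variables (lambda mu e : R) (p : S -> R).
Variables (P : probability W R) (L : R -> W -> nat) (X : R -> W -> S).
Hypotheses (lambda0 : 0 < lambda) (tK : transition_function K).
Hypotheses (inv : invariant_distribution K nu) (bp : bounded_measurable p).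
Hypothesis PQ : p_queue K lambda mu p e nu P L X.

Let measurable_nonempty t k : 0 <= t -> measurable (nonempty_upto L t k).
Proof. by move=> t0; have [[Q [_ _ mp]] _ _ _] := PQ; exact: (measurable_nonempty_upto mp t0). Qed.

Let measurable_term t k : 0 <= t ->
  measurable_fun setT (fun w => (t * \1_(nonempty_upto L t k) w)%:E : \bar R).
Proof.
move=> t0; apply/measurable_EFinP; apply: measurable_funM => //.
exact: measurable_indic (measurable_nonempty k t0).
Qed.

Lemma measurable_grid_exit t : 0 <= t -> measurable_fun setT (grid_exit L t).
Proof.
move=> t0; apply: ge0_emeasurable_sum => [k w _ _|k _]; first by rewrite lee_fin mulr_ge0.
exact: measurable_term.
Qed.

Lemma integral_grid_exit t : 0 <= t ->
  (\int[P]_w grid_exit L t w = \sum_(k <oo) (t * survival P L t k)%:E)%E.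
Proof.
move=> t0; rewrite integral_nneseries//.
- apply: eq_eseriesr => k _; rewrite /=.
  under eq_integral do rewrite EFinM.
  have mk := measurable_nonempty k t0.
  rewrite ge0_integralZl//; last exact/measurable_EFinP/measurable_indic.
  by rewrite integral_indic// setIT EFinM fineK// fin_num_measure.
- by move=> k; exact: measurable_term.
- by move=> k w _; rewrite lee_fin mulr_ge0.
Qed.

Let survival_ge0 t k : 0 <= survival P L t k.
Proof. by rewrite /survival fine_ge0. Qed.

Lemma le_integral_grid_exit t n : 0 <= t ->
  ((t * \sum_(k < n) survival P L t k)%:E <= \int[P]_w grid_exit L t w)%E.
Proof.
move=> t0; rewrite integral_grid_exit//.
apply: le_trans (nneseries_lim_ge n _); last by move=> k _ _; rewrite lee_fin mulr_ge0.
by rewrite big_mkord sumEFin mulr_sumr.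
Qed.

Lemma integral_grid_exit_le t c : 0 <= t ->
  (forall n, t * \sum_(k < n) survival P L t k <= c) ->
  (\int[P]_w grid_exit L t w <= c%:E)%E.
Proof.
move=> t0 H; rewrite integral_grid_exit//; apply: lime_le.
  by apply: is_cvg_nneseries => n _ _; rewrite lee_fin mulr_ge0.
by apply: nearW => n; rewrite big_mkord sumEFin lee_fin -mulr_sumr.
Qed.

(** Dominated convergence, the exit time of the coarsest grid being the dominating function. *)
Lemma cvg_integral_grid_exit t : 0 < t -> (\int[P]_w grid_exit L t w < +oo)%E ->
  (fun n => \int[P]_w grid_exit L (t / (2 ^ n)%:R) w)%E @ \oo -->
    (\int[P]_w busy_period L w)%E.
Proof.
move=> t0 fin; have [_ L_right _ _] := PQ.
have tn0 n : 0 <= t / (2 ^ n)%:R by rewrite divr_ge0// ltW.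
have ge0 s w : 0 <= s -> (0 <= grid_exit L s w)%E.
  by move=> s0; apply: nneseries_ge0 => n _ _; rewrite lee_fin mulr_ge0.
have mg n : measurable_fun setT (grid_exit L (t / (2 ^ n)%:R)).
  exact: measurable_grid_exit.
have cv w : (fun n => grid_exit L (t / (2 ^ n)%:R) w) @ \oo --> busy_period L w.
  exact: cvg_grid_exit.
have ig : P.-integrable setT (grid_exit L t).
  apply/integrableP; split; first exact: measurable_grid_exit (ltW t0).
  by under eq_integral do rewrite gee0_abs ?ge0 ?(ltW t0)//.
have [] // := @dominated_convergence _ _ _ P setT measurableT
  (fun n => grid_exit L (t / (2 ^ n)%:R)) (busy_period L) (grid_exit L t) mg _ _ ig _.
- exact: emeasurable_fun_cvg mg _.
- exact: aeW.
- apply: aeW => w n _; rewrite gee0_abs ?ge0//.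
  by apply: grid_exit_refine; rewrite // expn_gt0.
Qed.

Variables (b k : R).
Hypotheses (b0 : lambda < b) (k0 : 0 <= k).
Local Notation rate := (fun x => mu + e * p x).

Let bnd_rate : bounded_measurable rate.
Proof.
apply: bounded_measurableD; first exact: bounded_measurable_cst.
by apply: bounded_measurableM => //; exact: bounded_measurable_cst.
Qed.

Let bl0 : 0 < b - lambda. Proof. by rewrite subr_gt0. Qed.

(** The constant of [transition_near] for the rate bound [b + k] and the increment bound obtained
    from [Phi = 1 + k / (b - lambda)]; the remainder of one step is [t * (t * error)]. *)
Let error := (lambda + (b + k)) * (2 * ((lambda + (b + k)) * ((1 + k / (b - lambda)) / (b - lambda)))).

Lemma grid_exit_upper t : 0 < t -> t * (lambda + b) <= 1 ->
  (forall x, b - k <= rate x <= b) ->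
  0 < 1 - (k / (b - lambda)) ^+ 2 - t * error ->
  (\int[P]_w grid_exit L t w <=
    ((b - lambda)^-1 * (1 + (\int[nu]_x (b - rate x)) / (b - lambda)) /
    (1 - (k / (b - lambda)) ^+ 2 - t * error))%:E)%E.
Proof.
move=> t0 tb hr; set den := 1 - _ - _ => den0.
have [[Q [_ HQ mp]] _ L1 X0] := PQ.
set g := b - lambda; have g0 : 0 < g := bl0.
pose u x := b - rate x.
have bu : bounded_measurable u.
  by apply: bounded_measurableB => //; exact: bounded_measurable_cst.
have u0k x : 0 <= u x <= k by have /andP[h1 h2] := hr x; rewrite /u; apply/andP; split; lra.
have u0 x : 0 <= u x by case/andP: (u0k x).
(* This payoff cancels, up to the order (k / g) ^ 2, the error made in
   [transition_near] by replacing the death rate with b. *)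
pose psi x := t + g^-1 * time_integral K t u x.
have bt := bounded_measurable_time_integral K (ltW t0) bu u0.
have bZt : bounded_measurable (fun x => g^-1 * time_integral K t u x).
  by apply: bounded_measurableM => //; exact: bounded_measurable_cst.
have bpsi : bounded_measurable psi.
  by apply: bounded_measurableD => //; exact: bounded_measurable_cst.
have tik x : 0 <= time_integral K t u x <= t * k.
  by have := time_integral_bounds K (ltW t0) bu x u0k; rewrite mulr0.
have psi0 x : 0 <= psi x.
  by case/andP: (tik x) => h _; rewrite /psi addr_ge0 ?(ltW t0)// mulr_ge0// invr_ge0 ltW.
have psile x : psi x <= t * (1 + k / g).
  have -> : t * (1 + k / g) = t + g^-1 * (t * k) by ring.
  by case/andP: (tik x) => _ h; rewrite lerD2l ler_wpM2l// invr_ge0 ltW.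
pose F := test_function K lambda b t psi.
have bF m : bounded_measurable (F m) := bounded_measurable_test_function K lambda0 b0 t0 tb bpsi m.
have incF m l x := test_function_increment K lambda0 b0 t0 tb bpsi psi0 m l x psile.
have rb x : `|rate x| <= b + k.
  by have /andP[h1 h2] := hr x; rewrite ler_norml; apply/andP; split; have := (lambda0, b0, k0) => -[[]]; lra.
have bz : bounded_measurable (fun _ : S => 0 : R) by exact: bounded_measurable_cst.
have near x : - u x <= rate x - b <= 0.
  by have /andP[h1 h2] := hr x; rewrite /u; apply/andP; split; lra.
have step m l x : \int[Q (t, (l.+1, x))]_y F m y <= F m.+1 (l.+1, x) - t * den.
  have /andP[_] := transition_near tK HQ bp (ltW lambda0) rb bz bu (fun=> lexx 0) u0 near
    (bF m) (incF m) l x (ltW t0).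
  move=> /le_trans; apply; rewrite [F m.+1 _]/= -/(F m) -/error.
  set E := base_step _ _ _ _ _ _ _.
  case/andP: (tik x) => h1 h2; rewrite /psi -/g.
  have q0 : 0 <= k / g by rewrite divr_ge0// ltW.
  (* The increments reach (1 + k / g) / g while the payoff compensates only 1 / g. The rest is of
     second order because [time_integral] is at most [t * k]. *)
  have h3 : (k / g) * (g^-1 * time_integral K t u x) <= t * (k / g) ^+ 2.
    have -> : t * (k / g) ^+ 2 = (k / g) * (g^-1 * (t * k)) by ring.
    by rewrite !ler_wpM2l// invr_ge0 ltW.
  have -> : (1 + k / g) / g * time_integral K t u x =
    g^-1 * time_integral K t u x + (k / g) * (g^-1 * time_integral K t u x) by ring.
  have -> : t * den = t - t * (k / g) ^+ 2 - t * (t * error) by rewrite /den -/g; ring.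
  lra.
have nuT c : \int[nu]_x c = c.
  by rewrite Rintegral_cst// [X in fine X](probability_setT nu) mulr1.
have psiE : \int[nu]_x psi x = t * (1 + (\int[nu]_x u x) / g).
  rewrite RintegralD//; do ?[exact: probability_integrable bZt
    |apply: probability_integrable; exact: bounded_measurable_cst].
  rewrite RintegralZl//; last exact: probability_integrable bt.
  by rewrite nuT (Rintegral_time_integral (ltW t0) bu u0 inv); ring.
apply: integral_grid_exit_le (ltW t0) _ => n.
rewrite ler_pdivlMr//.
have := survival_sum_le mp (ltW t0) bF (test_function0 K lambda b t psi) (fun=> erefl) L1 X0 step n.
rewrite /F (Rintegral_test_function lambda0 b0 t0 tb bpsi inv) psiE.
have tl0 : 0 < t * lambda by rewrite mulr_gt0.
have tlb : t * lambda < t * b by rewrite ltr_pM2l.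
have tlb1 : t * lambda + t * b <= 1 by rewrite -mulrDr.
have := walk_lifetime_le tl0 tlb tlb1 n 1.
rewrite mul1r -mulrBr -/g => we.
have nu0 : 0 <= \int[nu]_x u x by apply: Rintegral_ge0.
move=> H; rewrite mulrAC; apply: (le_trans H).
have -> : g^-1 * (1 + (\int[nu]_x u x) / g) = (t * g)^-1 * (t * (1 + (\int[nu]_x u x) / g)).
  by field; rewrite !gt_eqF.
apply: ler_wpM2r => //; rewrite mulr_ge0 ?(ltW t0)// addr_ge0//; exact: divr_ge0 nu0 (ltW g0).
Qed.

Lemma mean_busy_period_upper : (forall x, b - k <= rate x <= b) ->
  k < b - lambda ->
  (exists2 t, 0 < t & (\int[P]_w grid_exit L t w < +oo)%E) /\
  (\int[P]_w busy_period L w <=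
    ((b - lambda)^-1 * (1 + (\int[nu]_x (b - rate x)) / (b - lambda)) /
    (1 - (k / (b - lambda)) ^+ 2))%:E)%E.
Proof.
move=> hr kb; set U := _ * (1 + _); set c := 1 - _.
have [_ L_right _ _] := PQ.
have q1 : 0 <= k / (b - lambda) < 1 by rewrite divr_ge0 ?(ltW bl0)//= ltr_pdivrMr// mul1r.
have c0 : 0 < c by rewrite subr_gt0 expr_lt1//; case/andP: q1.
have lb0 : 0 < lambda + b by have := (lambda0, b0) => -[]; lra.
have err0 : 0 < error.
  have h : 0 < lambda + (b + k) by have := (lambda0, b0, k0) => -[[]]; lra.
  have h' : 0 < 1 + k / (b - lambda) by rewrite ltr_wpDr//; case/andP: q1.
  exact: (mulr_gt0 h (mulr_gt0 (ltr0Sn R 1) (mulr_gt0 h (divr_gt0 h' bl0)))).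
have err20 : 0 < 2 * error := mulr_gt0 (ltr0Sn R 1) err0.
(* The first term makes the Euler step a convex combination; the second keeps the denominator above
   [c / 2]. *)
pose T := Num.min (lambda + b)^-1 (c / (2 * error)).
have T0 : 0 < T by rewrite lt_min invr_gt0 lb0 divr_gt0.
have small t : t <= T -> t * (lambda + b) <= 1 /\ c / 2 <= c - t * error.
  rewrite le_min => /andP[h1 h2]; split.
    by rewrite -ler_pdivlMr// mul1r.
  by move: h2; rewrite ler_pdivlMr// => h2; lra.
have tau_le t : 0 < t -> t <= T ->
    (\int[P]_w grid_exit L t w <= (U / (c - t * error))%:E)%E.
  move=> t0 /small[h1 h2]; apply: grid_exit_upper => //.
  by apply: lt_le_trans h2; rewrite divr_gt0.
have finT : (\int[P]_w grid_exit L T w < +oo)%E.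
  exact: (le_lt_trans (tau_le T T0 (lexx T)) (ltry _)).
split; first by exists T.
have B_le t : 0 < t -> t <= T -> (\int[P]_w busy_period L w <= (U / (c - t * error))%:E)%E.
  move=> t0 tT; apply: le_trans (tau_le t t0 tT).
  apply: le_integral_nonmeasurable => w _; exact: busy_period_le_grid_exit.
have B0 : (0 <= \int[P]_w busy_period L w)%E.
  apply: integral_ge0 => w _; apply: le_ereal_inf_tmp => _ [s [s0 _] <-].
  by rewrite lee_fin.
have Bfin : (\int[P]_w busy_period L w)%E \is a fin_num.
  by rewrite ge0_fin_numE//; exact: le_lt_trans (B_le T T0 (lexx T)) (ltry _).
move: B0 B_le; rewrite -(fineK Bfin) lee_fin => B0 B_le.
set v := fine _ in B0 B_le *.
(* The mesh tends to 0 here: [t] is chosen so that [t * (v * error) <= eta], the added 1 covering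
   the case [v = 0]. *)
rewrite lee_fin ler_pdivlMr//; apply/ler_addgt0Pr => eta eta0.
have ve0 : 0 < v * error + 1 by rewrite ltr_wpDl// mulr_ge0// ltW.
pose t := Num.min T (eta / (v * error + 1)).
have t0 : 0 < t by rewrite lt_min T0 divr_gt0.
have tT : t <= T by rewrite ge_min lexx.
have te : t <= eta / (v * error + 1) by rewrite ge_min lexx orbT.
have [_ h2] := small t tT.
have den0 : 0 < c - t * error by apply: lt_le_trans h2; rewrite divr_gt0.
have := B_le t t0 tT; rewrite lee_fin ler_pdivlMr// => h.
move: te; rewrite ler_pdivlMr// => te.
have -> : v * c = v * (c - t * error) + (t * (v * error + 1) - t) by ring.
lra.
Qed.

(** The walk lifetime is kept as it is, because its limit in [n] has to be taken before the mesh
    tends to 0. *)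
Lemma walk_lifetime_grid_exit_le t n : 0 < t -> t * (lambda + b) <= 1 ->
  (forall x, b <= rate x <= b + k) -> k <= b - lambda ->
  walk_lifetime (t * lambda) (t * b) n 1 *
    (t * (1 - (\int[nu]_x (rate x - b)) / (b - lambda))) <=
  (1 + t * ((lambda + (b + k)) * (2 * ((lambda + (b + k)) / (b - lambda))))) *
  (t * \sum_(k < n) survival P L t k).
Proof.
move=> t0 tb hr kb; set C := (lambda + (b + k)) * _.
have [[Q [_ HQ mp]] _ L1 X0] := PQ.
set g := b - lambda; have g0 : 0 < g := bl0.
pose u x := rate x - b.
have bu : bounded_measurable u.
  by apply: bounded_measurableB => //; exact: bounded_measurable_cst.
have u0k x : 0 <= u x <= k by have /andP[h1 h2] := hr x; rewrite /u; apply/andP; split; lra.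
have u0 x : 0 <= u x by case/andP: (u0k x).
(* Here the increments of the test function are at most 1 / g, and the error of
   [transition_near] is cancelled exactly. *)
pose psi x := t - g^-1 * time_integral K t u x.
have bt := bounded_measurable_time_integral K (ltW t0) bu u0.
have bZt : bounded_measurable (fun x => g^-1 * time_integral K t u x).
  by apply: bounded_measurableM => //; exact: bounded_measurable_cst.
have bpsi : bounded_measurable psi.
  by apply: bounded_measurableB => //; exact: bounded_measurable_cst.
have tik x : 0 <= time_integral K t u x <= t * k.
  by have := time_integral_bounds K (ltW t0) bu x u0k; rewrite mulr0.
have psi0 x : 0 <= psi x.
  (* The compensated payoff stays nonnegative because [k <= b - lambda]; without its sign the
     increments of the test function would not be known to be nonnegative. *)
  case/andP: (tik x) => _ h; rewrite /psi subr_ge0 mulrC ler_pdivrMr//.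
  by apply: le_trans h _; rewrite ler_pM2l.
have psile x : psi x <= t * 1.
  case/andP: (tik x) => h _; rewrite mulr1 /psi gerBl.
  by rewrite mulr_ge0// invr_ge0 ltW.
pose F := test_function K lambda b t psi.
have bF m : bounded_measurable (F m) := bounded_measurable_test_function K lambda0 b0 t0 tb bpsi m.
have incF m l x := test_function_increment K lambda0 b0 t0 tb bpsi psi0 m l x psile.
have rb x : `|rate x| <= b + k.
  by have /andP[h1 h2] := hr x; rewrite ler_norml; apply/andP; split; have := (lambda0, b0, k0) => -[[]]; lra.
have bz : bounded_measurable (fun _ : S => 0 : R) by exact: bounded_measurable_cst.
have near x : - 0 <= rate x - b <= u x.
  by have /andP[h1 h2] := hr x; rewrite /u; apply/andP; split; lra.
have step m l x : F m.+1 (l.+1, x) - t * (1 + t * C) <= \int[Q (t, (l.+1, x))]_y F m y.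
  have /andP[] := transition_near tK HQ bp (ltW lambda0) rb bu bz u0 (fun=> lexx 0) near
    (bF m) (incF m) l x (ltW t0).
  move=> h _; apply: le_trans h; rewrite [F m.+1 _]/= -/(F m) div1r -/C /psi.
  lra.
have nuT c : \int[nu]_x c = c.
  by rewrite Rintegral_cst// [X in fine X](probability_setT nu) mulr1.
have psiE : \int[nu]_x psi x = t * (1 - (\int[nu]_x u x) / g).
  rewrite RintegralB//; do ?[exact: probability_integrable bZt
    |apply: probability_integrable; exact: bounded_measurable_cst].
  rewrite RintegralZl//; last exact: probability_integrable bt.
  by rewrite nuT (Rintegral_time_integral (ltW t0) bu u0 inv); ring.
have := survival_sum_ge mp (ltW t0) bF (test_function0 K lambda b t psi) (fun=> erefl) L1 X0 step n.
rewrite /F (Rintegral_test_function lambda0 b0 t0 tb bpsi inv) psiE.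
by rewrite mulrA [t * (1 + _)]mulrC.
Qed.

Lemma mean_busy_period_lower t : 0 < t -> (\int[P]_w grid_exit L t w < +oo)%E ->
  (forall x, b <= rate x <= b + k) -> k <= b - lambda ->
  (((b - lambda)^-1 * (1 - (\int[nu]_x (rate x - b)) / (b - lambda)))%:E <=
    \int[P]_w busy_period L w)%E.
Proof.
move=> t0 fin hr kb.
set C := (lambda + (b + k)) * (2 * ((lambda + (b + k)) / (b - lambda))).
set D := 1 - _ / _.
have C0 : 0 <= C.
  have h : 0 <= lambda + (b + k) by have := (lambda0, b0, k0) => -[[]]; lra.
  by rewrite /C mulr_ge0// mulr_ge0// divr_ge0// ltW.
pose tn n := t / (2 ^ n)%:R.
have tn0 n : 0 < tn n by rewrite divr_gt0// ltr0n expn_gt0.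
pose T n := (\int[P]_w grid_exit L (tn n) w)%E.
have Tge0 n : (0 <= T n)%E.
  apply: integral_ge0 => w _; apply: nneseries_ge0 => m _ _.
  by rewrite lee_fin mulr_ge0// ltW.
have Tfin n : T n \is a fin_num.
  rewrite ge0_fin_numE//; apply: le_lt_trans fin.
  apply: le_integral_nonmeasurable => w _.
  by apply: grid_exit_refine; rewrite ?expn_gt0.
have cT : T @ \oo --> (\int[P]_w busy_period L w)%E by exact: cvg_integral_grid_exit.
have ctn : tn @ \oo --> (0 : R).
  have -> : tn = geometric t 2^-1.
    by apply/funext => n; rewrite /tn/= natrX exprVn.
  by apply: cvg_geometric; rewrite ger0_norm ?invr_ge0// invf_lt1// ltr1n.
have bound n : tn n * (lambda + b) <= 1 ->
    (b - lambda)^-1 * D <= (1 + tn n * C) * fine (T n).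
  move=> tb; have tg : tn n != 0 by rewrite gt_eqF.
  have tl0 : 0 < tn n * lambda by rewrite mulr_gt0.
  have tlb : tn n * lambda < tn n * b by rewrite ltr_pM2l.
  have tlb1 : tn n * lambda + tn n * b <= 1 by rewrite -mulrDr.
  (* The truncation is removed at fixed mesh: the partial sums of survival probabilities stay below
     the mean grid exit, while the walk lifetime converges. *)
  have cw := cvg_walk_lifetime1 tl0 tlb tlb1.
  have -> : (b - lambda)^-1 * D = (tn n * b - tn n * lambda)^-1 * (tn n * D).
    by rewrite -mulrBr; field; rewrite tg gt_eqF.
  apply: (cvgr_to_le (cvgM cw (cvg_cst (tn n * D)))).
  apply: nearW => m; apply: le_trans (walk_lifetime_grid_exit_le m (tn0 n) tb hr kb) _.
  apply: ler_wpM2l; first by rewrite addr_ge0// mulr_ge0// ltW.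
  by rewrite -lee_fin fineK//; exact: le_integral_grid_exit (ltW _).
have lb0 : 0 < lambda + b by have := (lambda0, b0) => -[]; lra.
have B_ge0 : (0 <= \int[P]_w busy_period L w)%E.
  by apply: (cvge_to_ge cT); exact: nearW.
have Bfin : (\int[P]_w busy_period L w)%E \is a fin_num.
  rewrite ge0_fin_numE//; apply: le_lt_trans fin.
  by apply: le_integral_nonmeasurable => w _; exact: busy_period_le_grid_exit.
have cR : (fun n => fine (T n)) @ \oo --> fine (\int[P]_w busy_period L w)%E.
  by apply: fine_cvg; rewrite fineK.
have cbound : (fun n => (1 + tn n * C) * fine (T n)) @ \oo -->
    (1 + 0 * C) * fine (\int[P]_w busy_period L w)%E.
  exact: (cvgM (cvgD (cvg_cst (1 : R)) (cvgM ctn (cvg_cst C))) cR).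
rewrite mul0r addr0 mul1r in cbound.
rewrite -(fineK Bfin) lee_fin; apply: (cvgr_to_ge cbound).
have : \forall n \near \oo, tn n < (lambda + b)^-1.
  by apply: cvgr_lt ctn _ _; rewrite invr_gt0.
apply: filterS => n tnl; apply: bound.
by rewrite -ler_pdivlMr// mul1r ltW.
Qed.

End mean_busy_period.

(** * Second order control of the two explicit bounds *)

Section expansion.
Context (R : realType) (g y q : R).
Hypotheses (g0 : 0 < g) (y0 : 0 <= y) (y4 : y <= 4^-1) (qy : `|q| <= y).

Let hyps : [/\ 0 < g, 0 <= y, y <= 4^-1, - y <= q & q <= y].
Proof. by split => //; move: qy; rewrite ler_norml => /andP[]. Qed.

(** Used with y = e M / g and q = e N / g, where [N] is the stationary mean of [p], [b = mu + g * y]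
    and [k = 2 * (g * y)]. The terms of first order in [y] cancel, and those of second order are 3
    y^2 + 2 q y, at most 5 y^2; the constant 6 leaves room for higher orders. *)
Lemma mean_upper_expansion :
  (g + g * y)^-1 * (1 + (g * y - g * q) / (g + g * y)) / (1 - (2 * (g * y) / (g + g * y)) ^+ 2)
  <= g^-1 * (1 - q + 6 * y ^+ 2).
Proof.
have [h1 h2 h3 h4 h5] := hyps.
have d0 : 0 < (1 - y) * (1 + 3 * y) by rewrite mulr_gt0//; lra.
have y1 : 1 + y != 0 by rewrite gt_eqF//; lra.
have -> : (g + g * y)^-1 * (1 + (g * y - g * q) / (g + g * y)) /
    (1 - (2 * (g * y) / (g + g * y)) ^+ 2) =
    g^-1 * ((1 + 2 * y - q) / ((1 - y) * (1 + 3 * y))).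
  field; rewrite (gt_eqF h1).
  have -> : (g + g * y) ^+ 2 - (2 * (g * y)) ^+ 2 = g ^+ 2 * ((1 - y) * (1 + 3 * y)) by ring.
  have -> : g + g * y = g * (1 + y) by ring.
  by rewrite !mulf_neq0 ?expf_neq0 ?gt_eqF//; lra.
rewrite ler_pM2l ?invr_gt0// ler_pdivrMr//.
have qy1 : q * y <= y * y by rewrite ler_wpM2r.
have qy2 : - y * y ^+ 2 <= q * y ^+ 2 by rewrite ler_wpM2r// sqr_ge0.
have y2 : 0 <= y ^+ 2 * (1 + 9 * y - 18 * y ^+ 2) by rewrite mulr_ge0 ?sqr_ge0//; nra.
rewrite -subr_ge0.
have -> : (1 - q + 6 * y ^+ 2) * ((1 - y) * (1 + 3 * y)) - (1 + 2 * y - q) =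
  y ^+ 2 * (1 + 9 * y - 18 * y ^+ 2) + 2 * (y * y - q * y) +
  3 * (q * y ^+ 2 - - y * y ^+ 2) by ring.
by rewrite !addr_ge0// mulr_ge0// subr_ge0.
Qed.

Lemma mean_lower_expansion :
  g^-1 * (1 - q - 6 * y ^+ 2) <=
  (g - g * y)^-1 * (1 - (g * y + g * q) / (g - g * y)).
Proof.
have [h1 h2 h3 h4 h5] := hyps.
have d0 : 0 < (1 - y) ^+ 2 by rewrite exprn_gt0//; lra.
have y1 : 1 - y != 0 by rewrite gt_eqF//; lra.
have -> : (g - g * y)^-1 * (1 - (g * y + g * q) / (g - g * y)) =
    g^-1 * ((1 - 2 * y - q) / (1 - y) ^+ 2).
  field; rewrite (gt_eqF h1) y1.
  have -> : g - g * y = g * (1 - y) by ring.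
  rewrite /= mulf_neq0//; first exact: lt0r_neq0.
rewrite ler_pM2l ?invr_gt0// ler_pdivlMr//.
have qy1 : q * y <= y * y by rewrite ler_wpM2r.
have qy2 : - y * y ^+ 2 <= q * y ^+ 2 by rewrite ler_wpM2r// sqr_ge0.
(* The bound [y <= 1 / 4] keeps this quadratic nonnegative: its smaller root is slightly above
   0.26. *)
have y2 : 0 <= y ^+ 2 * (3 - 13 * y + 6 * y ^+ 2) by rewrite mulr_ge0 ?sqr_ge0//; nra.
rewrite -subr_ge0.
have -> : 1 - 2 * y - q - (1 - q - 6 * y ^+ 2) * (1 - y) ^+ 2 =
  y ^+ 2 * (3 - 13 * y + 6 * y ^+ 2) + 2 * (y * y - q * y) +
  (q * y ^+ 2 - - y * y ^+ 2) by ring.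
by apply: addr_ge0; [apply: addr_ge0 => //; rewrite mulr_ge0// subr_ge0|rewrite subr_ge0].
Qed.

End expansion.

Theorem proposition4 (R : realType) (d : measure_display) (S : measurableType d)
    (K : R.-pker (R * S) ~> S) (nu : probability S R)
    (lambda mu M : R) (p : S -> R)
    (d' : measure_display) (W : R -> measurableType d')
    (P : forall e : R, probability (W e) R)
    (L : forall e : R, R -> W e -> nat) (X : forall e : R, R -> W e -> S)
    (hlambda : 0 < lambda) (hmu : lambda < mu)
    (hK : transition_function K)
    (hinv : invariant_distribution K nu)
    (herg : ergodic K nu)
    (hp : measurable_fun setT p)
    (hM : 0 < M) (hpM : forall x, `|p x| <= M)
    (hLX : forall e : R, 0 <= e -> e * sup (range (fun x => `|p x|)) < mu ->
       p_queue K lambda mu p e nu (P e) (L e) (X e)) :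
  exists2 r : R -> R,
    r =o_nonneg_nbhs0 (fun e : R => e) &
    \forall e \near nonneg_nbhs0,
      (\int[P e]_w busy_period (L e) w)%E =
      ((mu - lambda)^-1 - e * ((\int[nu]_x p x) / (mu - lambda) ^+ 2) + r e)%:E.
Proof.
have bp : bounded_measurable p by split => //; exists M.
set g := mu - lambda; have g0 : 0 < g by rewrite subr_gt0.
set N := \int[nu]_x p x.
have ip : nu.-integrable setT (EFin \o p) by exact: probability_integrable.
have nuT c : \int[nu]_x c = c :> R.
  by rewrite Rintegral_cst// [X in fine X](probability_setT nu) mulr1.
have ic c : nu.-integrable setT (EFin \o (fun=> c : R)).
  by apply: probability_integrable; exact: bounded_measurable_cst.
have NM : `|N| <= M.
  have hp' x : - M <= p x <= M by rewrite -ler_norml.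
  rewrite ler_norml; apply/andP; split; [rewrite -(nuT (- M))|rewrite -[X in _ <= X]nuT].
    by apply: (le_Rintegral measurableT (ic _) ip) => x _; case/andP: (hp' x).
  by apply: (le_Rintegral measurableT ip (ic _)) => x _; case/andP: (hp' x).
have rateE e : \int[nu]_x (mu + e * p x) = mu + e * N.
  rewrite RintegralD//; first by rewrite nuT RintegralZl.
  apply: probability_integrable; apply: bounded_measurableM => //.
  exact: bounded_measurable_cst.
pose EB e := (\int[P e]_w busy_period (L e) w)%E.
pose main e := g^-1 - e * (N / g ^+ 2).
(* An explicit quadratic remainder on an explicit range of [e], where [e * M <= g / 4] is the
   condition [y <= 1 / 4] of the expansions. *)
have bound e : 0 <= e -> e * M <= g / 4 ->
    EB e \is a fin_num /\ `|fine (EB e) - main e| <= e ^+ 2 * (6 * M ^+ 2 / g ^+ 3).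
  move=> e0 eM.
  have PQ : p_queue K lambda mu p e nu (P e) (L e) (X e).
    apply: hLX => //; apply: (@le_lt_trans _ _ (e * M)).
      rewrite ler_wpM2l//; apply: ge_sup; first by exists `|p point|; exists point.
      by move=> _ [x _ <-].
    by apply: (le_lt_trans eM); rewrite /g; have := (hlambda, hmu) => -[]; lra.
  pose y := e * M / g; pose q := e * N / g.
  have gy : e * M = g * y by rewrite /y [RHS]mulrC divfK// gt_eqF.
  have gq : e * N = g * q by rewrite /q [RHS]mulrC divfK// gt_eqF.
  have y0 : 0 <= y := divr_ge0 (mulr_ge0 e0 (ltW hM)) (ltW g0).
  have y4 : y <= 4^-1 by rewrite /y ler_pdivrMr// [leRHS]mulrC.
  have qy : `|q| <= y.
    rewrite /q normrM normfV (gtr0_norm g0) normrM (ger0_norm e0).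
    by apply: ler_wpM2r; [rewrite invr_ge0 ltW|exact: ler_wpM2l].
  have pe x : - (g * y) <= e * p x <= g * y.
    by rewrite -gy -ler_norml normrM (ger0_norm e0) ler_wpM2l.
  have gy0 : 0 <= g * y by rewrite mulr_ge0// ltW.
  have gy4 : g * y <= g / 4 by rewrite -gy.
  have k0 : 0 <= 2 * (g * y) by rewrite mulr_ge0.
  have mug : mu = g + lambda by rewrite /g; ring.
  have brate : bounded_measurable (fun x => mu + e * p x).
    apply: bounded_measurableD; first exact: bounded_measurable_cst.
    by apply: bounded_measurableM => //; exact: bounded_measurable_cst.
  have irate := probability_integrable nu brate.
  (* [2 * (g * y)] is the width of the interval of death rates, reached from its upper end here and
     from its lower end next; both smallness conditions follow from [y <= 1 / 4]. *)
  have [bU kU] : lambda < mu + g * y /\ 2 * (g * y) < mu + g * y - lambda.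
    by rewrite mug; split; lra.
  have [bL kL] : lambda < mu - g * y /\ 2 * (g * y) <= mu - g * y - lambda.
    by rewrite mug; split; lra.
  have hU x : mu + g * y - 2 * (g * y) <= mu + e * p x <= mu + g * y.
    by have /andP[u1 u2] := pe x; apply/andP; split; lra.
  have hL x : mu - g * y <= mu + e * p x <= mu - g * y + 2 * (g * y).
    by have /andP[u1 u2] := pe x; apply/andP; split; lra.
  have [[t t0 tfin] upper] := mean_busy_period_upper hlambda hK hinv bp PQ bU k0 hU kU.
  have lower := mean_busy_period_lower hlambda hK hinv bp PQ bL k0 t0 tfin hL kL.
  have EB0 : (0 <= EB e)%E.
    apply: integral_ge0 => w _; apply: le_ereal_inf_tmp => _ [s [s0 _] <-].
    by rewrite lee_fin.
  have EBfin : EB e \is a fin_num.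
    by rewrite ge0_fin_numE//; apply: (le_lt_trans upper); exact: ltry.
  split => //.
  have mainE : main e = g^-1 * (1 - q).
    by rewrite /main /q; field; rewrite gt_eqF.
  have errE : e ^+ 2 * (6 * M ^+ 2 / g ^+ 3) = g^-1 * (6 * y ^+ 2).
    by rewrite /y; field; rewrite gt_eqF.
  have guE : mu + g * y - lambda = g + g * y by rewrite mug; ring.
  have glE : mu - g * y - lambda = g - g * y by rewrite mug; ring.
  move: upper lower; rewrite -/(EB e) -(fineK EBfin) !lee_fin guE glE.
  rewrite RintegralB// nuT rateE gq RintegralB// nuT rateE gq.
  have -> : mu + g * y - (mu + g * q) = g * y - g * q by ring.
  have -> : mu + g * q - (mu - g * y) = g * y + g * q by ring.
  move=> upper lower.
  have := le_trans upper (mean_upper_expansion g0 y0 y4 qy).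
  have := le_trans (mean_lower_expansion g0 y0 y4 qy) lower.
  rewrite errE mainE ler_norml [g^-1 * (1 - q - _)]mulrBr [g^-1 * (1 - q + _)]mulrDr.
  move: (g^-1 * (1 - q)) (g^-1 * (6 * y ^+ 2)) (fine _) => m r v h1 h2 /=.
  by apply/andP; split; lra.
pose e0 := g / 4 / M.
have e00 : 0 < e0 by rewrite !divr_gt0.
have near_bound (Q : R -> Prop) a : 0 < a ->
    (forall e, 0 <= e -> e < a -> e * M <= g / 4 -> Q e) ->
    \forall e \near nonneg_nbhs0, Q e.
  move=> a0 HQ.
  suff : nbhs (0 : R) [set e | 0 <= e -> Q e] by [].
  exists (Num.min a e0); first by rewrite /= lt_min a0.
  move=> e /=; rewrite sub0r normrN => /ltr_normlW.
  rewrite lt_min => /andP[ea ee0] ege0; apply: HQ => //.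
  by rewrite -ler_pdivlMr// ltW.
(* [fine] gives the remainder a value for every [e]; near 0 the mean is finite, so nothing is lost
   there. *)
exists (fun e => fine (EB e) - main e).
  apply/eqoP => c c0.
  set D := 6 * M ^+ 2 / g ^+ 3 in bound *.
  have D0 : 0 < D by rewrite divr_gt0 ?exprn_gt0// mulr_gt0 ?exprn_gt0.
  apply: (near_bound _ (c / D)); first exact: divr_gt0.
  move=> e e_ge0 ec eM; have [_ h] := bound e e_ge0 eM; apply: (le_trans h).
  rewrite (ger0_norm e_ge0) expr2 -mulrA mulrC ler_wpM2r//.
  by rewrite -ler_pdivlMr// ltW.
apply: (near_bound _ 1) => // e e_ge0 _ eM.
have [fin _] := bound e e_ge0 eM.
by rewrite -/(EB e) -/(main e) addrC subrK fineK.
Qed.
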